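(* Consider the problem $$(\ast)\qquad \max_{\delta\in\Delta}\int_{\Theta_1}g(p(\theta;\delta))\,\Lambda_1(d\theta)\quad\text{subject to } \int_{\Theta_0}p(\theta;\delta)\,\Lambda_0(d\theta)\le\alpha .$$ Suppose that (A1) $\lim_{n\to\infty}\int_{\mathbb{Y}}|f_{\theta_n}(y)-f_\theta(y)|\,\mu(dy)=0$ whenever $\theta_n,\theta\in\Theta$, $\theta_n\to\theta$, and $\mu_\theta,\mu_{\theta'}$ are mutually absolutely continuous for all $\theta,\theta'\in\Theta$; and (A2) $g$ is continuously differentiable on $(0,1)$ and continuous at $0$ and $1$. Let $\tilde f_{\Theta_0}(y):=\int_{\Theta_0}f_\theta(y)\,\Lambda_0(d\theta)$ for $y\in\mathbb{Y}$. (i) If the rule $\bar\delta_0\equiv0$ is not an optimal solution to $(\ast)$, then there exist a rule $\delta^*\in\Delta$, a constant $\kappa\in\mathbb{R}$, and a measurable function $\gamma:\mathbb{Y}\to[0,1]$ such that $\delta^*$ solves $(\ast)$ and, for each $y\in\mathbb{Y}$, $$\delta^*(y)=\begin{cases}1,&H(y)>\kappa\tilde f_{\Theta_0}(y)\\ \gamma(y),&H(y)=\kappa\tilde f_{\Theta_0}(y)\\ 0,&H(y)<\kappa\tilde f_{\Theta_0}(y),\end{cases}\qquad\text{where } H(y):=\int_{\Theta_1}g'(p(\theta;\delta^* ))f_\theta(y)\,\Lambda_1(d\theta).$$ (ii) If $\bar\delta_0$ is not an optimal solution to $(\ast)$, then any optimal rule $\delta^*\in\Delta$ for $(\ast)$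 must take the form displayed in (i) (with $H$ defined from this $\delta^*$, for some $\kappa\in\mathbb{R}$ and measurable $\gamma:\mathbb{Y}\to[0,1]$) for $\mu$-almost every $y$. (iii) If, in addition to (A1) and (A2), $g'(t)>0$ for all $0<t<1$, then $\bar\delta_0$ is not an optimal solution to $(\ast)$, and for any optimal rule $\delta^*\in\Delta$ for $(\ast)$ we have $\int_{\Theta_0}p(\theta;\delta^* )\,\Lambda_0(d\theta)=\alpha$.
   Context: Let $\Theta\subset\mathbb{R}^{d_1}$ ($d_1\ge1$) be compact and partitioned into two disjoint non-empty (measurable) subsets $\Theta_0$ and $\Theta_1=\Theta\setminus\Theta_0$. Let $\mathbb{Y}\subset\mathbb{R}^{d_2}$ ($d_2\ge1$) be the observation space, $\mu$ a $\sigma$-finite measure on $\mathbb{Y}$, and for each $\theta\in\Theta$ let $f_\theta$ be a probability density function with respect to $\mu$; $(\theta,y)\mapsto f_\theta(y)$ is jointly measurable. Let $\mu_\theta$ be the probability measure with $d\mu_\theta/d\mu=f_\theta$. $\Delta$ is the set of all randomized decision rules, i.e. measurable functions $\delta:\mathbb{Y}\to[0,1]$, and $p(\theta;\delta)=\int_{\mathbb{Y}}\delta(y)f_\theta(y)\,\mu(dy)$. Here $\alpha\in(0,1)$, $g:[0,1]\to\mathbb{R}$ is a measurable function, and $\Lambda_0,\Lambda_1$ are probability measures on $\Theta_0$ and $\Theta_1$ respectively. $\bar\delta_0$ denotes the rule with $\bar\delta_0(y)=0$ for all $y\in\mathbb{Y}$. (When $\bar\delta_0$ is not optimal, every optimal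 rule $\delta^*$ satisfies $p(\theta;\delta^* )\in(0,1)$ for all $\theta\in\Theta$, so $g'(p(\theta;\delta^* ))$ is well defined.) *)

(* Defs.v *)
From HB Require Import structures.
From mathcomp Require Import all_boot all_order all_algebra.
From mathcomp Require Import all_classical all_reals all_analysis.

Set Implicit Arguments.
Unset Strict Implicit.
Unset Printing Implicit Defensive.

Import Order.TTheory GRing.Theory Num.Theory.
Import numFieldNormedType.Exports.

Local Open Scope classical_set_scope.
Local Open Scope ring_scope.

(* 'rV[R]_d with its Borel sigma-algebra; the underlying type is 'rV[R]_d, so
   that a set of row vectors can be used on both sides. *)
Notation borel_rV R d := (g_sigma_algebraType (@open 'rV[R]_d)).

(* The library requires measurable types to be pointed, hence the argument Y0;
   the choice of the point plays no role. *)
Definition pointed_subset (T : choiceType) (Y : set T) (Y0 : Y !=set0) : Type :=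
  set_type Y.

Section pointed_subset_instances.
Variables (T : choiceType) (Y : set T) (Y0 : Y !=set0).

HB.instance Definition _ := Choice.on (pointed_subset Y0).
HB.instance Definition _ := isPointed.Build (pointed_subset Y0)
  (SigSub (mem_set (projT2 (cid Y0)))).

End pointed_subset_instances.

Definition subset_val (R : realType) d (Y : set 'rV[R]_d) (Y0 : Y !=set0) :
  pointed_subset Y0 -> borel_rV R d := fun y => sval y.

(* The points of Y, with the trace on Y of the Borel sigma-algebra of R^d
   (Y itself need not be Borel). *)
Notation trace_borel Y0 := (g_sigma_algebra_preimageType (@subset_val _ _ _ Y0)).

Section problem.
Context (R : realType) (d1 : nat) (dY : measure_display) (Y : measurableType dY).
Variable mu : {measure set Y -> \bar R}.
Variable f : 'rV[R]_d1 -> Y -> R.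
Variables Theta Theta0 Theta1 : set 'rV[R]_d1.
Variables Lambda0 Lambda1 : probability (borel_rV R d1) R.
Variable g : R -> R.
Variable alpha : R.

Definition is_pdf (h : Y -> R) :=
  [/\ measurable_fun setT h, forall y, 0 <= h y &
      (\int[mu]_y (h y)%:E = 1)%E].

Definition density_family :=
  (forall theta, Theta theta -> is_pdf (f theta)) /\
  measurable_fun ((Theta : set (borel_rV R d1)) `*` [set: Y])
    (fun z => f z.1 z.2).

Definition mu_ (theta : 'rV[R]_d1) (A : set Y) : \bar R :=
  (\int[mu]_(y in A) (f theta y)%:E)%E.

Definition L1_continuous_family :=
  forall (u : nat -> 'rV[R]_d1) (theta : 'rV[R]_d1),
    (forall n, Theta (u n)) -> Theta theta -> u n @[n --> \oo] --> theta ->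
    (\int[mu]_y `|f (u n) y - f theta y|%:E)%E @[n --> \oo] --> 0%E.

Definition mutually_ac_family :=
  forall theta theta', Theta theta -> Theta theta' ->
    (mu_ theta `<< mu_ theta') /\ (mu_ theta' `<< mu_ theta).

Definition assumption_A1 := L1_continuous_family /\ mutually_ac_family.

(* Only the values of g on [0, 1] matter: the end points are approached from
   inside the interval. *)
Definition assumption_A2 :=
  derivable_oo_LRcontinuous g 0 1 /\ {in `]0, 1[, continuous g^`()%classic}.

Definition Delta : set (Y -> R) :=
  [set delta : Y -> R | measurable_fun setT delta /\ forall y, 0 <= delta y <= 1].

Definition reject_prob (theta : 'rV[R]_d1) (delta : Y -> R) : R :=
  \int[mu]_y (delta y * f theta y).

Definition objective (delta : Y -> R) : R :=
  \int[Lambda1]_(theta in Theta1) g (reject_prob theta delta).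

Definition avg_size (delta : Y -> R) : R :=
  \int[Lambda0]_(theta in Theta0) reject_prob theta delta.

Definition feasible (delta : Y -> R) := Delta delta /\ avg_size delta <= alpha.

Definition optimal (delta : Y -> R) :=
  feasible delta /\
  forall delta', feasible delta' -> objective delta' <= objective delta.

(* The two mixtures are extended-real valued: they may be infinite for y in a
   mu-negligible set. *)
Definition f_mix0 (y : Y) : \bar R :=
  (\int[Lambda0]_(theta in Theta0) (f theta y)%:E)%E.

Definition Hmix1 (delta : Y -> R) (y : Y) : \bar R :=
  (\int[Lambda1]_(theta in Theta1)
     (g^`()%classic (reject_prob theta delta) * f theta y)%:E)%E.

Definition NP_form (delta gamma : Y -> R) (kappa : R) (y : Y) :=
  [/\ (kappa%:E * f_mix0 y < Hmix1 delta y)%E -> delta y = 1,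
      (Hmix1 delta y = kappa%:E * f_mix0 y)%E -> delta y = gamma y &
      (Hmix1 delta y < kappa%:E * f_mix0 y)%E -> delta y = 0].

End problem.

(* Main.v *)
Require Import Defs.
From mathcomp Require Import all_boot all_order all_algebra.
From mathcomp Require Import all_classical all_reals all_analysis.
From mathcomp Require Import measurable_realfun ring lra.
Set Implicit Arguments.
Unset Strict Implicit.
Unset Printing Implicit Defensive.
Import Order.TTheory GRing.Theory Num.Theory.
Import numFieldNormedType.Exports.
Local Open Scope classical_set_scope.
Local Open Scope ring_scope.

(** Existence. The rejection probabilities of all rules are equicontinuous on the
    compact parameter set, so a maximizing sequence has a subsequence along which
    they converge uniformly to some function P ([equicontinuous_subseq]). The
    rules whose rejection probabilities are close to P form decreasing convex
    sets; elements of nearly minimal L2 norm in these sets are Cauchy by the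
    parallelogram identity, and yield an almost everywhere limit delta
    ([convex_ae_limit]) whose rejection probabilities are exactly P
    ([rules_weakly_sequentially_compact]). Continuity of g on [0, 1] then makes
    delta optimal ([optimal_exists]).

    Form. Mutual absolute continuity implies that a rule with rejection
    probability 0 (or 1) at one parameter has it at all parameters. Hence, when
    the zero rule is not optimal, an optimal delta has all its rejection
    probabilities in a compact subset of the open unit interval, where g has a
    bounded derivative, and the objective can be differentiated along segments
    towards any rule of the same size ([optimal_first_order]). By Fubini
    ([mixture_fubini]) the resulting inequality says that delta maximizes the
    integral of H against rules of the same size under the null mixture. A
    maximizer of such a linear problem is a threshold rule, with threshold kappa
    found by an exchange argument ([neyman_pearson_necessary]). This proves (ii),
    and (i) follows by changing delta on a null set.

    Positive derivative. Then g increases strictly on [0, 1], so the constant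
    rule alpha beats the zero rule, and unused size could be spent to increase
    the objective. *)

(** * Integrals, limits and measurability of real functions *)

Lemma bounded_on (T : Type) (R : realType) (h : T -> R) (D : set T) (M : R) :
  (forall x, D x -> `|h x| <= M) -> [bounded h x | x in D].
Proof.
move=> hM; exists M; split; first exact: num_real.
by move=> x Mx t Dt; exact: le_trans (hM t Dt) (ltW Mx).
Qed.

Section integral_facts.
Context d (T : measurableType d) (R : realType) (mu : {measure set T -> \bar R}).
Implicit Types (D : set T) (h w : T -> R).

Lemma integrable_bounded_mul D h w (M : R) : measurable D ->
  measurable_fun D h -> (forall x, D x -> `|h x| <= M) ->
  mu.-integrable D (EFin \o w) -> mu.-integrable D (EFin \o (fun x => h x * w x)).
Proof.
move=> mD mh hM iw.
have := integrableMr mD mh (bounded_on hM) iw.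
by apply: eq_integrable => // x _.
Qed.

Lemma Rintegral_dominated_cvg D (u : nat -> T -> R) (v w : T -> R) :
  measurable D -> (forall n, measurable_fun D (u n)) -> measurable_fun D v ->
  {ae mu, forall x, D x -> u n x @[n --> \oo] --> v x} ->
  mu.-integrable D (EFin \o w) ->
  (forall n x, D x -> `|u n x| <= w x) ->
  (\int[mu]_(x in D) u n x) @[n --> \oo] --> \int[mu]_(x in D) v x.
Proof.
move=> mD meas_u mv uv iw uw.
have [] := @dominated_convergence _ _ _ mu _ mD (fun n => EFin \o u n)
  (EFin \o v) (EFin \o w) _ _ _ iw.
- by move=> n; exact/measurable_EFinP.
- exact/measurable_EFinP.
- by apply: filterS uv => x /= uvx Dx; apply: cvg_EFin; [exact: nearW|exact: uvx].
- by apply: aeW => x n Dx; rewrite /= lee_fin uw.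
- move=> iv _ uv'; apply: fine_cvg.
  by rewrite fineK//; exact: integrable_fin_num.
Qed.

Lemma Rintegral_eq0 D h : (forall x, D x -> h x = 0) -> \int[mu]_(x in D) h x = 0.
Proof.
move=> h0; rewrite (_ : 0 = \int[mu]_(x in D) cst 0 x).
  by apply: eq_Rintegral => x /set_mem; exact: h0.
by rewrite /Rintegral integral0.
Qed.

Lemma Rintegral_ge0_eq0 D h : measurable D -> mu.-integrable D (EFin \o h) ->
  (forall x, D x -> 0 <= h x) -> \int[mu]_(x in D) h x = 0 ->
  {ae mu, forall x, D x -> h x = 0}.
Proof.
move=> mD ih h0 ih0.
have : (\int[mu]_(x in D) `|(EFin \o h) x| = 0)%E.
  under eq_integral => x /set_mem Dx do rewrite /= ger0_norm ?h0//.
  by rewrite -(fineK (integrable_fin_num mD ih)); congr EFin.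
move/(ae_eq_integral_abs mu mD (measurable_int _ ih)).
by apply: filterS => x /= + Dx => /(_ Dx)[].
Qed.

Lemma ae_eq_Rintegral D h w : measurable D ->
  measurable_fun D h -> measurable_fun D w ->
  {ae mu, forall x, D x -> h x = w x} ->
  \int[mu]_(x in D) h x = \int[mu]_(x in D) w x.
Proof.
move=> mD mh mw hw; congr fine; apply: ae_eq_integral => //.
- exact/measurable_EFinP.
- exact/measurable_EFinP.
- by apply: filterS hw => x /= + Dx => /(_ Dx) ->.
Qed.

End integral_facts.

Lemma cvg_within_seq (R : realType) (g : R -> R) (A : set R) (u : nat -> R) (l : R) :
  {within A, continuous g} -> (forall n, A (u n)) -> A l ->
  u n @[n --> \oo] --> l -> g (u n) @[n --> \oo] --> g l.
Proof.
move=> /subspace_continuousP cg uA Al ul.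
apply: cvg_trans (cg l Al) => B /= ; rewrite /within/= => hB.
move: (ul _ hB); rewrite /= => -[N _ NB].
by exists N => // n /NB; apply.
Qed.

Lemma measurable_lt_set d (T : measurableType d) (R : realType) (f g : T -> R) :
  measurable_fun setT f -> measurable_fun setT g -> measurable [set x | f x < g x].
Proof.
move=> mf mg; rewrite -[X in measurable X]setTI.
exact: (measurable_fun_ltr mf mg measurableT (Y := [set true])).
Qed.

(** * Uniform cluster points of equicontinuous sequences *)

Lemma fmap_ultra (S T : Type) (f : S -> T) (U : set_system S) :
  UltraFilter U -> UltraFilter (f @ U).
Proof.
move=> UU; split=> [|G PG UG]; first exact: fmap_proper_filter.
rewrite eqEsubset; split => // A GA.
have [//|UnA] := @in_ultra_setVsetC _ U (f @^-1` A) UU.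
by have [x []] := filter_ex (filterI GA (UG (~` A) UnA)).
Qed.

(** The limit P is taken along an ultrafilter, where it exists at every point at
    once; equicontinuity and compactness make the convergence uniform, and a
    uniform limit along an ultrafilter is approached by a subsequence. *)
Lemma equicontinuous_subseq (R : realType) (T : topologicalType) (K : set T)
    (u : nat -> T -> R) : compact K ->
  (forall n x, K x -> 0 <= u n x <= 1) ->
  (forall x (e : R), K x -> 0 < e ->
    \forall x' \near x, K x' -> forall n, `|u n x' - u n x| <= e) ->
  exists P : T -> R, exists phi : nat -> nat, forall k,
    (k <= phi k)%N /\ forall x, K x -> `|u (phi k) x - P x| <= k.+1%:R^-1.
Proof.
move=> cK u01 eu.
have [U [UU ooU]] := ultraFilterLemma (eventually_filter : ProperFilter \oo).
have PU : ProperFilter U by exact: ultra_proper.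
have [P uP] : exists P : T -> R, forall x, K x -> u n x @[n --> U] --> P x.
  suff /choice[P uP] : forall x, exists l : R, K x -> u n x @[n --> U] --> l.
    by exists P.
  move=> x.
  have [Kx|nKx] := pselect (K x); last by exists 0.
  have := @segment_compact R 0 1; rewrite compact_ultra => /=.
  have Uux : UltraFilter (u n x @[n --> U]) by exact: fmap_ultra.
  move=> /(_ _ Uux) [|l [_ ul]]; last by exists l.
  by apply: (@filterE _ U) => n /=; rewrite in_itv/= u01.
(* near each point of K the index and the point can be moved independently, so
   compactness gives one set of indices that works on all of K *)
have unif (e : R) : 0 < e -> \near U, K `<=` (fun x => `|u U x - P x| <= e).
  move=> e0; have e30 : 0 < e / 3 by rewrite divr_gt0.
  suff : \near U, K `<=` (fun x => K x -> `|u U x - P x| <= e).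
    by apply: filterS => n Kn x Kx; exact: Kn.
  apply: (compact_near_coveringP K).1 => // x Kx.
  have near_u := cvgr_distC_le _ _ (uP x Kx) _ e30.
  exists ([set x' | K x' -> forall n, `|u n x' - u n x| <= e / 3],
          [set n | `|u n x - P x| <= e / 3]).
    by split; [exact: eu|exact: near_u].
  move=> [x' n] [/= eux' unx] Kx'.
  have Px' : `|P x' - P x| <= e / 3.
    apply: (@cvgr_to_le _ U _ _ (fun m => `|u m x' - u m x|)).
      by apply: cvg_norm; apply: cvgB; exact: uP.
    by apply: nearW => m; exact: eux'.
  have -> : u n x' - P x' = (u n x' - u n x) + (u n x - P x) - (P x' - P x).
    by ring.
  rewrite (_ : e = e / 3 + e / 3 + e / 3); last by field.
  rewrite (le_trans (ler_normB _ _))// lerD// (le_trans (ler_normD _ _))// lerD//.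
  exact: eux'.
have ex k : exists n, (k <= n)%N /\ forall x, K x -> `|u n x - P x| <= k.+1%:R^-1.
  have k0 : 0 < k.+1%:R^-1 :> R by rewrite invr_gt0.
  have Uk : U [set n | (k <= n)%N] by apply: ooU; exists k.
  have [n [kn Kn]] := filter_ex (filterI Uk (unif _ k0)).
  by exists n.
exists P.
by have [phi ?] := choice ex; exists phi.
Qed.

(** * Almost everywhere limits from decreasing convex sets of rules *)

Section fast_convergence.
Context d (T : measurableType d) (R : realType) (mu : {measure set T -> \bar R}).

(** The telescoping series has a finite integral, hence converges absolutely
    wherever the weight does not vanish, outside a null set. *)
Lemma fast_L1_cauchy_ae_cvg (e : nat -> T -> R) (w : T -> R) (r : R) :
  (forall n, measurable_fun setT (e n)) -> measurable_fun setT w ->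
  (forall x, 0 <= w x) ->
  (forall n, (\int[mu]_x (`|e n.+1 x - e n x| * w x)%:E <=
              (r / (2 ^ (n + 1))%:R)%:E)%E) ->
  {ae mu, forall x, w x != 0 -> cvgn (e ^~ x)}.
Proof.
move=> me mw w0 er.
pose D n x := `|e n.+1 x - e n x| * w x.
have D0 n x : 0 <= D n x by rewrite mulr_ge0.
have mD n : measurable_fun setT (fun x => (D n x)%:E).
  apply/measurable_EFinP; apply: measurable_funM => //.
  by apply: measurableT_comp => //; exact: measurable_funB.
have mSD : measurable_fun setT (fun x => \sum_(0 <= n <oo) (D n x)%:E)%E.
  apply: (ge0_emeasurable_sum (P := xpredT)) => // n x _ _.
  by rewrite lee_fin.
have SD : (\int[mu]_x (\sum_(0 <= n <oo) (D n x)%:E) < +oo)%E.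
  rewrite integral_nneseries//; last by move=> n x _; rewrite lee_fin.
  apply: (@le_lt_trans _ _ (\sum_(0 <= n <oo) (r / (2 ^ (n + 1))%:R)%:E)%E).
    apply: lee_nneseries => [n _ _|n _]; last exact: er.
    by apply: integral_ge0 => x _; rewrite lee_fin.
  by have /cvg_lim -> // := @cvg_geometric_eseries_half R r 0; exact: ltry.
have iSD : mu.-integrable setT (fun x => \sum_(0 <= n <oo) (D n x)%:E)%E.
  apply/integrableP; split => //; under eq_integral => x _.
    rewrite gee0_abs; last by apply: nneseries_ge0 => n _ _; rewrite lee_fin.
    over.
  exact: SD.
have := integrable_ae measurableT iSD; apply: filterS => x /= /(_ I) Dfin w_neq0.
have wx0 : 0 < w x by rewrite lt_def w_neq0 w0.
have cD : cvgn (series (D ^~ x)).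
  by apply: nnseries_is_cvg => //; rewrite ltey_eq Dfin.
have cn : cvgn [normed series (fun n => e n.+1 x - e n x)].
  have := is_cvg_seriesZ (k := (w x)^-1) cD.
  rewrite (_ : series _ = [normed series (fun n => e n.+1 x - e n x)])//.
  apply/funext => n; rewrite /series/=; apply: eq_bigr => k _.
  transitivity ((w x)^-1 * D k x); first by [].
  by rewrite /D mulrCA mulVf// mulr1.
have := normed_cvg cn.
rewrite (_ : series _ = (fun n => e n x - e 0%N x)); last first.
  by apply/funext => n; rewrite /series/= telescope_sumr.
move=> ce; have -> : e^~ x = (fun n => e n x - e 0%N x + e 0%N x).
  by apply/funext => n; rewrite subrK.
by apply: is_cvgD => //; exact: is_cvg_cst.
Qed.

End fast_convergence.

Section convex_ae_limit.
Context d (Y : measurableType d) (R : realType) (mu : {measure set Y -> \bar R}).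
Variables (w : Y -> R) (C : nat -> set (Y -> R)).
Hypothesis iw : mu.-integrable setT (EFin \o w).
Hypothesis w0 : forall y, 0 <= w y.
Hypothesis C_rule : forall n e, C n e -> Delta e.
Hypothesis C_neq0 : forall n, C n !=set0.
Hypothesis C_decr : forall m n, (m <= n)%N -> C n `<=` C m.
Hypothesis C_mid : forall n a b, C n a -> C n b -> C n (fun y => (a y + b y) / 2).

Let mw : measurable_fun setT w.
Proof. by apply/measurable_EFinP; exact: measurable_int iw. Qed.

(** The squared norm of e in the Hilbert space with weight w. *)
Let N (e : Y -> R) := \int[mu]_y (e y ^+ 2 * w y).

Let W := \int[mu]_y w y.

Let iN (h : Y -> R) (M : R) : measurable_fun setT h -> (forall y, `|h y| <= M) ->
  mu.-integrable setT (EFin \o (fun y => h y * w y)).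
Proof. by move=> mh hM; exact: (integrable_bounded_mul measurableT mh (fun y _ => hM y) iw). Qed.

Let iN2 e : Delta e -> mu.-integrable setT (EFin \o (fun y => e y ^+ 2 * w y)).
Proof.
move=> [me e01]; apply: (iN (M := 1)); first exact: measurable_funX.
move=> y; have /andP[e0 e1] := e01 y.
by rewrite ger0_norm ?sqr_ge0// expr_le1.
Qed.

Let N0 e : 0 <= N e.
Proof. by apply: Rintegral_ge0 => y _; rewrite mulr_ge0// sqr_ge0. Qed.

Let NW e : Delta e -> N e <= W.
Proof.
move=> De; apply: le_Rintegral => //; first exact: iN2.
move=> y _; have [_ /(_ y) /andP[e0 e1]] := De.
by rewrite ler_piMl// expr_le1.
Qed.

Let parallelogram a b : Delta a -> Delta b ->
  \int[mu]_y ((b y - a y) ^+ 2 * w y) =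
  2 * N a + 2 * N b - 4 * N (fun y => (a y + b y) / 2).
Proof.
move=> Da Db; have [ma a01] := Da; have [mb b01] := Db.
have Dm : Delta (fun y => (a y + b y) / 2).
  split=> [|y]; first by apply: measurable_funM => //; exact: measurable_funD.
  by have /andP[? ?] := a01 y; have /andP[? ?] := b01 y; apply/andP; split; lra.
have Z2 c e : Delta e -> mu.-integrable setT (EFin \o (fun y => c * (e y ^+ 2 * w y))).
  by move=> De; have := integrableZl measurableT c (iN2 De); exact: eq_integrable.
rewrite /N -!RintegralZl//; [|exact: iN2..].
rewrite -RintegralD//; [|exact: Z2..].
rewrite -RintegralB//; last 2 first.
- by have := integrableD measurableT (Z2 2 _ Da) (Z2 2 _ Db); exact: eq_integrable.
- exact: Z2.
by apply: eq_Rintegral => y _; field.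
Qed.

Let inf_N n := inf [set N e | e in C n].

Let has_inf_N n : has_inf [set N e | e in C n].
Proof.
split; first by have [e Ce] := C_neq0 n; exists (N e); exists e.
by exists 0 => _ [e _ <-]; exact: N0.
Qed.

Let s := sup (range inf_N).

Let has_sup_inf_N : has_sup (range inf_N).
Proof.
split; first by exists (inf_N 0); exists 0%N.
exists W => _ [n _ <-]; have [e Ce] := C_neq0 n.
apply: (@le_trans _ _ (N e)); last exact: NW (C_rule Ce).
by apply: ge_inf; [exact: (has_inf_N n).2|exists e].
Qed.

(** The infima of N over the sets C n increase to s, so that elements of C n of
    nearly minimal norm have nearly the norm s, and so do their midpoints. *)
Let N_gt (eps : R) : 0 < eps ->
  exists n, forall m e, (n <= m)%N -> C m e -> s - eps < N e.
Proof.
move=> eps0; have [_ [n _ <-] sn] := sup_adherent eps0 has_sup_inf_N.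
exists n => m e nm Ce; apply: lt_le_trans sn _.
by apply: ge_inf; [exact: (has_inf_N n).2|exists e => //; exact: C_decr Ce].
Qed.

Let N_lt (eps : R) n : 0 < eps -> exists e, C n e /\ N e < s + eps.
Proof.
move=> eps0; have [_ [e Ce <-] Ne] := inf_adherent eps0 (has_inf_N n).
exists e; split => //; apply: lt_le_trans Ne _; rewrite lerD2r.
by apply: sup_upper_bound => //; exists n.
Qed.

(** Hilbert space substitute for weak compactness: by the parallelogram
    identity, elements of nearly minimal norm in decreasing convex sets form a
    Cauchy sequence, and a fast subsequence converges almost everywhere. *)
Lemma convex_ae_limit : exists e : nat -> Y -> R, exists delta : Y -> R,
  [/\ forall k, C k (e k), Delta delta &
      {ae mu, forall y, w y != 0 -> e n y @[n --> \oo] --> delta y}].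
Proof.
(* eps k = 4 ^ - k, so that 2 ^ k * eps k is still summable *)
pose eps k : R := (2 ^+ k)^-2.
have eps0 k : 0 < eps k by rewrite invr_gt0 exprn_gt0// exprn_gt0.
have [n_ n_P] := choice (fun k => N_gt (eps0 k)).
(* any index at least n_ k and k that is monotone in k *)
pose m k := (k + \sum_(j < k.+1) n_ j)%N.
have nm k : (n_ k <= m k)%N by rewrite /m big_ord_recr/= addnA leq_addl.
have km k : (k <= m k)%N by rewrite leq_addr.
have mS k : (m k <= m k.+1)%N.
  by rewrite /m [in X in (_ <= X)%N]big_ord_recr/= addSn addnA leqW// leq_addr.
have [e eP] := choice (fun k => N_lt (m k) (eps0 k)).
have De k : Delta (e k) by exact: C_rule (eP k).1.
have ediff k : \int[mu]_y ((e k.+1 y - e k y) ^+ 2 * w y) <= 8 * eps k.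
  rewrite parallelogram//.
  have Nk := (eP k).2; have NSk := (eP k.+1).2.
  have Nmid : s - eps k < N (fun y => (e k y + e k.+1 y) / 2).
    apply: (n_P k (m k)) => //; apply: C_mid; first exact: (eP k).1.
    exact: (C_decr (mS k) (eP k.+1).1).
  have epsS : eps k.+1 <= eps k.
    rewrite lef_pV2 ?posrE ?exprn_gt0// ?exprn_gt0//.
    rewrite ler_pXn2r ?nnegrE ?exprn_ge0//.
    by rewrite exprS ler_peMl// ?exprn_ge0// ler1n.
  lra.
have eabs k y : `|e k.+1 y - e k y| <= 1.
  have /andP[? ?] := (De k).2 y; have /andP[? ?] := (De k.+1).2 y.
  by rewrite ler_norml; apply/andP; split; lra.
have mdiff k : measurable_fun setT (fun y => e k.+1 y - e k y).
  by apply: measurable_funB; [exact: (De _).1|exact: (De _).1].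
have iabs k : mu.-integrable setT (EFin \o (fun y => `|e k.+1 y - e k y| * w y)).
  apply: (iN (M := 1)) => [|y]; last by rewrite normr_id.
  by apply: measurableT_comp => //; exact: mdiff.
have isq k : mu.-integrable setT (EFin \o (fun y => (e k.+1 y - e k y) ^+ 2 * w y)).
  apply: (iN (M := 1)) => [|y]; first exact: measurable_funX.
  by rewrite normrX expr_le1.
have e_fast k : (\int[mu]_y (`|e k.+1 y - e k y| * w y)%:E <=
    (2 * (8 + W) / (2 ^ (k + 1))%:R)%:E)%E.
  rewrite -(fineK (integrable_fin_num measurableT (iabs k))) lee_fin.
  pose c : R := 2 ^+ k; have c0 : 0 < c by rewrite exprn_gt0.
  (* x <= c * x ^ 2 + 1 / c for x >= 0 *)
  have ic : mu.-integrable setT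
      (EFin \o (fun y => c * ((e k.+1 y - e k y) ^+ 2 * w y))).
    by have := integrableZl measurableT c (isq k); exact: eq_integrable.
  have iw' : mu.-integrable setT (EFin \o (fun y => c^-1 * w y)).
    by have := integrableZl measurableT c^-1 iw; exact: eq_integrable.
  apply: (@le_trans _ _ (\int[mu]_y (c * ((e k.+1 y - e k y) ^+ 2 * w y) + c^-1 * w y))).
    apply: le_Rintegral => //.
      by have := integrableD measurableT ic iw'; exact: eq_integrable.
    move=> y _; rewrite mulrA -mulrDl ler_wpM2r//.
    set x := _ - _; rewrite -(real_normK (num_real x)).
    rewrite -(ler_pM2l c0) mulrDr mulfV ?gt_eqF//.
    have := sqr_ge0 (c * `|x| - 1 / 2); lra.
  rewrite RintegralD// !RintegralZl//.
  have -> : 2 * (8 + W) / (2 ^ (k + 1))%:R = c * (8 * eps k) + c^-1 * W.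
    rewrite natrX exprD expr1 /eps -/c; field.
    by rewrite gt_eqF.
  by rewrite lerD2r ler_pM2l.
have ae_cvg := fast_L1_cauchy_ae_cvg (fun k => (De k).1) mw w0 e_fast.
(* the limit superior is measurable and defined everywhere; truncating it to
   [0, 1] changes nothing where the sequence converges *)
pose l y := fine (limn_esup (fun n => (e n y)%:E)).
have ml : measurable_fun setT l.
  apply: (measurableT_comp (fine_measurable measurableT)).
  by apply: measurable_fun_limn_esup => n; apply/measurable_EFinP; exact: (De n).1.
exists e, (fun y => Num.max 0 (Num.min 1 (l y))); split.
- by move=> k; exact: C_decr (km k) _ (eP k).1.
- split=> [|y].
    apply: measurable_maxr => //; exact: measurable_minr.
  by rewrite le_max lexx/= ge_max ler01/= ge_min lexx.
- apply: filterS ae_cvg => y /= ecv wy; have {}ecv := ecv wy.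
  have ecvg : e n y @[n --> \oo] --> limn (e^~ y) by exact: ecv.
  have -> : l y = limn (e^~ y).
    have elimE : (e n y)%:E @[n --> \oo] --> (limn (e^~ y))%:E.
      by apply: cvg_EFin; first exact: nearW.
    by rewrite /l; have [_ ->] := cvg_limn_einf_sup elimE.
  have l0 : 0 <= limn (e^~ y).
    by apply: limr_ge => //; apply: nearW => n; have /andP[] := (De n).2 y.
  have l1 : limn (e^~ y) <= 1.
    by apply: limr_le => //; apply: nearW => n; have /andP[] := (De n).2 y.
  by rewrite (min_idPr _)// (max_idPr _).
Qed.

End convex_ae_limit.

(** * Randomized rules and their rejection probabilities *)

Section rules.
Context (R : realType) (dY : measure_display) (Y : measurableType dY).
Implicit Types a b : Y -> R.

Lemma Delta_segment a b (t : R) : Delta a -> Delta b -> 0 <= t <= 1 ->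
  Delta (fun y => a y + t * (b y - a y)).
Proof.
move=> [ma a01] [mb b01] /andP[t0 t1]; split=> [|y].
  by apply: measurable_funD => //; apply: measurable_funM => //; exact: measurable_funB.
have /andP[? ?] := a01 y; have /andP[? ?] := b01 y.
by apply/andP; split; nra.
Qed.

Lemma Delta_norm a : Delta a -> forall y, `|a y| <= 1.
Proof. by move=> [_ d01] y; have /andP[? ?] := d01 y; rewrite ger0_norm. Qed.

Lemma Delta_cst (t : R) : 0 <= t <= 1 -> Delta (fun _ : Y => t).
Proof. by move=> t01; split=> // _; exact: t01. Qed.

Lemma Delta_compl a : Delta a -> Delta (fun y => 1 - a y).
Proof.
move=> [ma a01]; split=> [|y]; first exact: measurable_funB.
by have /andP[? ?] := a01 y; apply/andP; split; lra.
Qed.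

Lemma Delta_indic (A : set Y) : measurable A -> Delta (\1_A : Y -> R).
Proof.
by move=> mA; split=> // y; rewrite indicE; case: (y \in A); rewrite /= ?lexx ler01.
Qed.

End rules.

Section model.
Context (R : realType) (d1 : nat) (dY : measure_display) (Y : measurableType dY).
Variables (mu : {measure set Y -> \bar R}) (f : 'rV[R]_d1 -> Y -> R).
Variable Theta : set 'rV[R]_d1.
Hypothesis f_density : density_family mu f Theta.
Local Notation p := (reject_prob mu f).

Lemma density_integrable th : Theta th -> mu.-integrable setT (EFin \o f th).
Proof.
move=> /f_density.1[mf f0 f1]; apply/integrableP; split; first exact/measurable_EFinP.
under eq_integral => y _ do rewrite /= ger0_norm//.
by rewrite f1 ltry.
Qed.

Lemma Rintegral_density th : Theta th -> \int[mu]_y f th y = 1.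
Proof. by move=> /f_density.1[_ _ f1]; rewrite /Rintegral f1. Qed.

Lemma rule_integrable th (h : Y -> R) (M : R) : Theta th -> measurable_fun setT h ->
  (forall y, `|h y| <= M) -> mu.-integrable setT (EFin \o (fun y => h y * f th y)).
Proof.
move=> Th mh hM.
exact: (integrable_bounded_mul measurableT mh (fun y _ => hM y) (density_integrable Th)).
Qed.

Lemma Delta_integrable th (delta : Y -> R) : Theta th -> Delta delta ->
  mu.-integrable setT (EFin \o (fun y => delta y * f th y)).
Proof.
move=> Th [md d01]; apply: (rule_integrable (M := 1)) => // y.
by have /andP[? ?] := d01 y; rewrite ger0_norm.
Qed.

Lemma reject_prob01 th (delta : Y -> R) : Theta th -> Delta delta ->
  0 <= p th delta <= 1.
Proof.
move=> Th Dd; have [_ f0 _] := f_density.1 th Th; have [_ d01] := Dd.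
apply/andP; split.
  by apply: Rintegral_ge0 => y _; rewrite mulr_ge0//; have /andP[] := d01 y.
rewrite -(Rintegral_density Th); apply: le_Rintegral => //.
- exact: Delta_integrable.
- exact: density_integrable.
- by move=> y _; rewrite ler_piMl//; have /andP[] := d01 y.
Qed.

Lemma reject_prob_linear th (u v : Y -> R) (c M : R) : Theta th ->
  measurable_fun setT u -> (forall y, `|u y| <= M) ->
  measurable_fun setT v -> (forall y, `|v y| <= M) ->
  p th (fun y => u y + c * v y) = p th u + c * p th v.
Proof.
move=> Th meas_u uM mv vM; rewrite /reject_prob.
have iv := rule_integrable Th mv vM.
rewrite -RintegralZl// -RintegralD//; last 2 first.
- exact: rule_integrable uM.
- by have := integrableZl measurableT c iv; exact: eq_integrable.
by apply: eq_Rintegral => y _; rewrite mulrDl mulrA.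
Qed.

Lemma reject_prob_segment th (a b : Y -> R) (t : R) : Theta th ->
  Delta a -> Delta b ->
  p th (fun y => a y + t * (b y - a y)) = p th a + t * (p th b - p th a).
Proof.
move=> Th Da Db; have [[ma _] [mb _]] := (Da, Db).
rewrite (reject_prob_linear _ (M := 1)) //.
- have -> : (fun y => b y - a y) = (fun y => b y + (-1) * a y).
    by apply/funext => y; rewrite mulN1r.
  rewrite (reject_prob_linear _ (M := 1)) //; first by rewrite mulN1r.
  + exact: Delta_norm.
  + exact: Delta_norm.
- exact: Delta_norm.
- exact: measurable_funB.
- move=> y; have [_ /(_ y)/andP[? ?]] := Da; have [_ /(_ y)/andP[? ?]] := Db.
  by rewrite ler_norml; apply/andP; split; lra.
Qed.

Lemma reject_prob_cst th (t : R) : Theta th -> p th (fun=> t) = t.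
Proof.
move=> Th; rewrite /reject_prob RintegralZl//; last exact: density_integrable.
by rewrite Rintegral_density// mulr1.
Qed.

Lemma reject_prob_compl th (delta : Y -> R) : Theta th -> Delta delta ->
  p th (fun y => 1 - delta y) = 1 - p th delta.
Proof.
move=> Th Dd; have [md _] := Dd.
have -> : (fun y => 1 - delta y) = (fun y => 1 + (-1) * delta y).
  by apply/funext => y; rewrite mulN1r.
rewrite (reject_prob_linear _ (M := 1))// ?reject_prob_cst ?mulN1r//.
- by move=> _; rewrite normr1.
- exact: Delta_norm.
Qed.

(** The bound does not depend on the rule: rejection probabilities of all rules
    are equicontinuous in the parameter. *)
Lemma reject_prob_dist th th' (delta : Y -> R) (e : R) :
  Theta th -> Theta th' -> Delta delta ->
  (\int[mu]_y `|f th y - f th' y|%:E <= e%:E)%E -> `|p th delta - p th' delta| <= e.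
Proof.
move=> Th Th' Dd fe; rewrite /reject_prob.
have iB : mu.-integrable setT (EFin \o (fun y => f th y - f th' y)).
  have := integrableB measurableT (density_integrable Th) (density_integrable Th').
  exact: eq_integrable.
have iBn := integrable_norm iB.
have idB : mu.-integrable setT (EFin \o (fun y => delta y * (f th y - f th' y))).
  exact: (integrable_bounded_mul measurableT Dd.1 (fun y _ => Delta_norm Dd y) iB).
rewrite -RintegralB//; [|exact: Delta_integrable..].
under eq_Rintegral => y _ do rewrite -mulrBr.
apply: le_trans (le_normr_Rintegral measurableT idB) _.
apply: (@le_trans _ _ (\int[mu]_y `|f th y - f th' y|)).
  apply: le_Rintegral => //; first by have := integrable_norm idB; exact: eq_integrable.
  by move=> y _; rewrite normrM ler_piMl// Delta_norm.
by rewrite -lee_fin fineK//; exact: (integrable_fin_num measurableT iBn).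
Qed.

Hypothesis f_L1 : L1_continuous_family mu f Theta.

(** From sequences to neighbourhoods, which is what compactness arguments use. *)
Lemma L1_continuous_near th (e : R) : Theta th -> 0 < e ->
  \forall th' \near th, Theta th' -> (\int[mu]_y `|f th' y - f th y|%:E <= e%:E)%E.
Proof.
move=> Th e0; apply: contrapT => nP.
have ex n : exists x, [/\ ball th n.+1%:R^-1 x, Theta x &
    ~ (\int[mu]_y `|f x y - f th y|%:E <= e%:E)%E].
  apply: contrapT => nex; apply: nP.
  have n0 : 0 < n.+1%:R^-1 :> R by rewrite invr_gt0.
  apply/nbhs_ballP; exists n.+1%:R^-1 => //= x xb Tx.
  by apply: contrapT => nfe; apply: nex; exists x.
have [u uP] := choice ex.
have uth : u n @[n --> \oo] --> th.
  apply/cvg_ballP => r r0.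
  have [N _ NP] := near_infty_natSinv_lt (PosNum r0).
  exists N => // n /NP /= nr; have [+ _ _] := uP n.
  by apply: le_ball; exact: ltW.
have Tu n : Theta (u n) by have [] := uP n.
have := f_L1 Tu Th uth => /fine_cvgP[fin].
move=> /cvgrPdist_lt/(_ _ e0) [N _ NP].
have [N' _ N'P] := fin.
have [_ _] := uP (maxn N N'); apply.
rewrite -(fineK (N'P (maxn N N') (leq_maxr _ _))) lee_fin.
have := NP (maxn N N') (leq_maxl _ _); rewrite /= sub0r normrN => /ltW.
exact: le_trans (ler_norm _).
Qed.

Lemma reject_prob_equicontinuous th (e : R) : Theta th -> 0 < e ->
  \forall th' \near th, Theta th' ->
    forall delta, Delta delta -> `|p th' delta - p th delta| <= e.
Proof.
move=> Th e0; apply: filterS (L1_continuous_near Th e0) => th' /= fe Th' delta Dd.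
exact: reject_prob_dist (fe Th').
Qed.

Lemma reject_prob_continuous (delta : Y -> R) : Delta delta ->
  {within Theta, continuous (p ^~ delta)}.
Proof.
move=> Dd; apply/subspace_continuousP => th Th.
apply/cvgrPdist_le => e e0; rewrite near_withinE.
apply: filterS (reject_prob_equicontinuous Th e0) => th' /= pe Th'.
by rewrite distrC; exact: pe.
Qed.

End model.

(** * Mutual absolute continuity and weak compactness of the rules *)

Section absolute_continuity.
Context (R : realType) (d1 : nat) (dY : measure_display) (Y : measurableType dY).
Variables (mu : {measure set Y -> \bar R}) (f : 'rV[R]_d1 -> Y -> R).
Variable Theta : set 'rV[R]_d1.
Hypothesis f_density : density_family mu f Theta.
Hypothesis f_ac : mutually_ac_family mu f Theta.
Local Notation p := (reject_prob mu f).

Lemma density_null_transfer th th' (A : set Y) : Theta th -> Theta th' ->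
  measurable A -> {ae mu, forall y, A y -> f th y = 0} ->
  {ae mu, forall y, A y -> f th' y = 0}.
Proof.
move=> Th Th' mA fA0.
have mf t : Theta t -> measurable_fun setT (EFin \o f t).
  by move=> Tt; exact: measurable_int (density_integrable f_density Tt).
have [_ dom] := f_ac Th Th'.
have : (mu_ mu f th').-null_set A.
  apply: dom => B mB BA; rewrite /mu_.
  rewrite (ae_eq_integral (cst 0%E))//.
  - by rewrite integral0.
  - by apply: measurable_funS (mf _ Th).
  - by apply: filterS fA0 => y /= fA By; rewrite fA//; exact: BA.
move/(_ A mA (@subset_refl _ _)); rewrite /mu_ => f'A0.
have : (\int[mu]_(y in A) `|(EFin \o f th') y| = 0)%E.
  rewrite -[RHS]f'A0; apply: eq_integral => y _.
  by rewrite /= ger0_norm//; have [_ ->] := f_density.1 _ Th'.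
move/(ae_eq_integral_abs mu mA (measurable_funS measurableT (@subsetT _ _) (mf _ Th'))).
by apply: filterS => y /= + Ay => /(_ Ay)[].
Qed.

(** A rule that never rejects under one parameter never rejects under any other:
    the set where it is positive is null for one density, hence for all. *)
Lemma reject_prob_eq0 th th' (delta : Y -> R) : Theta th -> Theta th' ->
  Delta delta -> p th delta = 0 -> p th' delta = 0.
Proof.
move=> Th Th' Dd pd0; have [md d01] := Dd.
have d0 y : 0 <= delta y by have /andP[] := d01 y.
have f0 t y : Theta t -> 0 <= f t y.
  by move=> Tt; have [_ + _] := f_density.1 _ Tt; exact.
have mA : measurable [set y | 0 < delta y].
  exact: measurable_lt_set.
have : {ae mu, forall y, [set y | 0 < delta y] y -> f th y = 0}.
  have := Rintegral_ge0_eq0 measurableT (Delta_integrable f_density Th Dd)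
    (fun y _ => mulr_ge0 (d0 y) (f0 _ _ Th)) pd0.
  apply: filterS => y /= /(_ I)/eqP; rewrite mulf_eq0 => /orP[/eqP ->|/eqP//].
  by rewrite ltxx.
move/(density_null_transfer Th Th' mA) => fA0.
rewrite /reject_prob (ae_eq_Rintegral (w := cst 0))//.
- by rewrite /Rintegral integral0.
- by apply: measurable_funM => //; have [] := f_density.1 _ Th'.
- apply: filterS fA0 => y /= fy _.
  have := d0 y; rewrite le_eqVlt => /predU1P[<-|/fy ->]; first by rewrite mul0r.
  by rewrite mulr0.
Qed.

Lemma reject_prob_eq1 th th' (delta : Y -> R) : Theta th -> Theta th' ->
  Delta delta -> p th delta = 1 -> p th' delta = 1.
Proof.
move=> Th Th' Dd pd1.
have := reject_prob_eq0 Th Th' (Delta_compl Dd).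
by rewrite !(reject_prob_compl f_density)// pd1 subrr => /(_ erefl)/eqP;
  rewrite subr_eq0 => /eqP <-.
Qed.

Hypothesis Theta_compact : compact Theta.
Hypothesis f_L1 : L1_continuous_family mu f Theta.

(** The rejection probabilities of a subsequence converge uniformly in the
    parameter to some P. The rules whose rejection probabilities are uniformly
    close to P form decreasing convex sets, so some sequence e k of such rules
    converges almost everywhere to a rule delta; dominated convergence then
    shows that P is the rejection probability of delta. Convergence is only
    known where one fixed density f th0 is positive, which is enough because the
    densities vanish together. *)
Lemma rules_weakly_sequentially_compact (delta_ : nat -> Y -> R) :
  (forall n, Delta (delta_ n)) ->
  exists phi : nat -> nat, exists2 delta : Y -> R, Delta delta &
    (forall k, (k <= phi k)%N) /\
    forall th, Theta th -> p th (delta_ (phi k)) @[k --> \oo] --> p th delta.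
Proof.
move=> D_.
have [T0|/set0P[th0 Th0]] := eqVneq Theta set0.
  exists id, (delta_ 0%N) => //; split => // th; by rewrite T0.
have equi th (e : R) : Theta th -> 0 < e ->
    \forall th' \near th, Theta th' ->
      forall n, `|p th' (delta_ n) - p th (delta_ n)| <= e.
  move=> Th e0; have := reject_prob_equicontinuous f_density f_L1 Th e0.
  by apply: filterS => th' /= H Th' n; exact: H.
have [P [phi phiP]] := equicontinuous_subseq Theta_compact
  (fun n th Th => reject_prob01 f_density Th (D_ n)) equi.
have kk (k : nat) : 0 < k.+1%:R^-1 :> R by rewrite invr_gt0.
pose C k := [set delta : Y -> R | Delta delta /\
  forall th, Theta th -> `|p th delta - P th| <= k.+1%:R^-1].
have cvgP (e : nat -> Y -> R) th : Theta th -> (forall k, C k (e k)) ->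
    p th (e k) @[k --> \oo] --> P th.
  move=> Th Ce; apply/cvgrPdist_le => r r0.
  have [N _ NP] := near_infty_natSinv_lt (PosNum r0).
  exists N => // k /NP /= /ltW kr; rewrite distrC.
  exact: le_trans ((Ce k).2 th Th) kr.
have [_ f0 _] := f_density.1 _ Th0.
have [e [delta [Ce Dd ed]]] : exists e : nat -> Y -> R, exists delta : Y -> R,
    [/\ forall k, C k (e k), Delta delta &
        {ae mu, forall y, f th0 y != 0 -> e n y @[n --> \oo] --> delta y}].
  apply: convex_ae_limit => //.
  - exact: (density_integrable f_density).
  - by move=> n e [].
  - by move=> n; exists (delta_ (phi n)); split => //; exact: (phiP n).2.
  - move=> m n mn e [De eP]; split => // th Th; apply: le_trans (eP th Th) _.
    by rewrite lef_pV2 ?posrE// ler_nat.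
  - move=> n a b [Da aP] [Db bP].
    have -> : (fun y => (a y + b y) / 2) = (fun y => a y + 2^-1 * (b y - a y)).
      by apply/funext => y; field.
    have h01 : 0 <= (2^-1 : R) <= 1 by apply/andP; split; lra.
    split; first exact: Delta_segment.
    move=> th Th; rewrite (reject_prob_segment f_density)//.
    have := aP _ Th; have := bP _ Th; move: (n.+1%:R^-1) => x.
    rewrite !ler_norml => /andP[? ?] /andP[? ?].
    by apply/andP; split; lra.
exists phi, delta => //; split=> [k|th Th]; first by have [] := phiP k.
have pe : p th (e k) @[k --> \oo] --> p th delta.
  have De k : Delta (e k) by have [] := Ce k.
  have [mf fth0 _] := f_density.1 _ Th.
  have mf0 : measurable [set y | f th0 y = 0].
    have [mf0 _ _] := f_density.1 _ Th0.
    by rewrite -[X in measurable X]setTI; exact: (mf0 measurableT [set 0]).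
  have := density_null_transfer Th0 Th mf0 (aeW _ (fun=> id)).
  move=> fth_ac.
  apply: (Rintegral_dominated_cvg measurableT _ _ _ (density_integrable f_density Th)).
  - by move=> n; apply: measurable_funM => //; exact: (De n).1.
  - by apply: measurable_funM => //; exact: Dd.1.
  - apply: filterS2 fth_ac ed => y /= fy ey _.
    have [/fy ->|/ey ey'] := eqVneq (f th0 y) 0; last exact: cvgMl.
    by under eq_fun do rewrite mulr0; rewrite mulr0; exact: cvg_cst.
  - by move=> n y _; rewrite normrM (ger0_norm (fth0 y)) ler_piMl// Delta_norm.
have <- : P th = p th delta.
  exact: (cvg_unique (@norm_hausdorff _ _) (cvgP _ _ Th Ce) pe).
by apply: (cvgP (delta_ \o phi)) => // k; split; [exact: D_|exact: (phiP k).2].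
Qed.

End absolute_continuity.

(** * Mixtures of densities *)

Lemma within_continuous_measurable_rV (R : realType) (d : nat)
    (A : set 'rV[R]_d) (h : 'rV[R]_d -> R) :
  measurable (A : set (borel_rV R d)) -> {within A, continuous h} ->
  measurable_fun (A : set (borel_rV R d)) (h : borel_rV R d -> R).
Proof.
move=> mA /continuousP ch; apply: (measurability _ (RGenOpens.measurableE R)).
move=> _ [_ [a [b ->] <-]].
have /open_subspaceP[V oV VA] : open (from_subspace A h @^-1` `]a, b[%classic).
  exact/ch/interval_open.
rewrite [X in measurable X](_ : _ = V `&` A); last by rewrite setIC -VA.
by apply: measurableI => //; exact: sub_sigma_algebra.
Qed.

Lemma compact_measurable_rV (R : realType) (d : nat) (A : set 'rV[R]_d) :
  compact A -> measurable (A : set (borel_rV R d)).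
Proof.
move=> /(compact_closed (@norm_hausdorff _ _))/closed_openC oA.
by rewrite -[X in measurable X]setCK; apply: measurableC; exact: sub_sigma_algebra.
Qed.

Section mixture.
Context (R : realType) (d1 : nat) (dY : measure_display) (Y : measurableType dY).
Variables (mu : {sigma_finite_measure set Y -> \bar R}) (f : 'rV[R]_d1 -> Y -> R).
Variable Theta : set 'rV[R]_d1.
Hypothesis f_density : density_family mu f Theta.
Hypothesis mTheta : measurable (Theta : set (borel_rV R d1)).
Variables (Lambda : probability (borel_rV R d1) R) (T : set (borel_rV R d1)).
Hypothesis mT : measurable T.
Hypothesis TTheta : T `<=` Theta.
Variables (c : 'rV[R]_d1 -> R) (M : R).
Hypothesis mc : measurable_fun T (c : borel_rV R d1 -> R).
Hypothesis cM : forall th, T th -> `|c th| <= M.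
Local Notation p := (reject_prob mu f).

(** The mixture of the densities with signed bounded weights c: both the null
    mixture (c = 1) and the function H of the theorem are of this form. *)
Definition mixture (y : Y) : \bar R :=
  (\int[Lambda]_(th in T) (c th * f th y)%:E)%E.

Let F (delta : Y -> R) (z : borel_rV R d1 * Y) : \bar R :=
  ((fun z => delta z.2 * (c z.1 * f z.1 z.2)) \_ (T `*` [set: Y]) z)%:E.

Let FE delta th y : F delta (th, y) =
  ((fun th => (delta y * (c th * f th y))%:E) \_ T) th.
Proof.
rewrite /F /restrict/= in_setX in_setT andbT.
by rewrite patchE/=; case: (th \in T).
Qed.

Let mF delta : measurable_fun setT delta -> measurable_fun setT (F delta).
Proof.
move=> md; apply/measurable_EFinP.
have mTY : measurable (T `*` [set: Y]) by exact: measurableX.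
have mf : measurable_fun (T `*` [set: Y]) (fun z => f z.1 z.2).
  apply: measurable_funS f_density.2; first exact: measurableX.
  by move=> z [/TTheta ? _]; split.
have mcz : measurable_fun (T `*` [set: Y]) (fun z => c z.1).
  apply: (measurable_comp mT _ mc); first by move=> _ [z [Tz _] <-].
  exact: measurable_funTS.
apply/(measurable_restrictT _ mTY).
apply: measurable_funM; last exact: measurable_funM.
by apply: measurable_funTS; exact: measurableT_comp.
Qed.

Let cf_integrable th (delta : Y -> R) : T th -> Delta delta ->
  mu.-integrable setT (fun y => (delta y * (c th * f th y))%:E).
Proof.
move=> Tth Dd; have := integrableZl measurableT (c th)
  (Delta_integrable f_density (TTheta Tth) Dd).
by apply: eq_integrable => // y _; rewrite /= -EFinM mulrCA.
Qed.

Let fubini_FE (delta : Y -> R) : Delta delta ->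
  fubini_F mu (F delta) = (fun th => (c th * p th delta)%:E) \_ T.
Proof.
move=> Dd; apply/funext => th; rewrite /fubini_F patchE.
under eq_integral => y _ do rewrite FE patchE.
case: ifPn => [/set_mem Tth|_]; last by rewrite integral0.
under eq_integral => y _ do rewrite mulrCA EFinM.
have iD := Delta_integrable f_density (TTheta Tth) Dd.
rewrite integralZl// EFinM; congr (_ * _)%E.
by rewrite fineK//; exact: (integrable_fin_num measurableT iD).
Qed.

Let iF (delta : Y -> R) : Delta delta -> (Lambda \x mu)%E.-integrable setT (F delta).
Proof.
move=> Dd; apply/integrable12ltyP; first exact: mF Dd.1.
apply: (@le_lt_trans _ _ (\int[Lambda]_th `|M|%:E)%E).
  apply: ge0_le_integral => //.
  - by move=> th _; apply: integral_ge0 => y _.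
  - apply: (measurable_fun_fubini_tonelli_F (abse \o F delta)) => //=.
    by apply: measurableT_comp => //; exact: mF Dd.1.
  - move=> th _; have [Tth|nTth] := boolP (th \in T); last first.
      rewrite (eq_integral (cst 0%E)) ?integral0 ?lee_fin// => y _.
      by rewrite FE patchE (negbTE nTth) abse0.
    rewrite (eq_integral (fun y => `|(delta y * (c th * f th y))%:E|%E)); last first.
      by move=> y _; rewrite FE patchE Tth.
    move/set_mem : Tth => Tth.
    have Th := TTheta Tth; have [mf f0 f1] := f_density.1 _ Th.
    rewrite -[leRHS]mule1 -[X in (_ * X)%E]f1 -ge0_integralZl//.
    + apply: ge0_le_integral => //.
      * by apply: measurableT_comp => //; exact: measurable_int (cf_integrable Tth Dd).
      * by apply/measurable_EFinP; apply: measurable_funM.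
      * move=> y _; rewrite /= lee_fin !normrM mulrA (ger0_norm (f0 y)) ler_wpM2r//.
        rewrite -[leRHS]mul1r ler_pM// ?Delta_norm//.
        exact: le_trans (cM Tth) (ler_norm M).
    + exact/measurable_EFinP.
    + by move=> y _; rewrite lee_fin.
by rewrite integral_cst//= probability_setT mule1 ltry.
Qed.

Let mixture_FE (delta : Y -> R) y : fubini_G Lambda (F delta) y =
  (\int[Lambda]_(th in T) (delta y * (c th * f th y))%:E)%E.
Proof.
by rewrite [RHS]integral_mkcond; apply: eq_integral => th _; rewrite FE.
Qed.

Lemma mixture_integrable : mu.-integrable setT mixture.
Proof.
have D1 : Delta (cst 1 : Y -> R) by apply: Delta_cst; rewrite lexx ler01.
have mixE : mixture = fubini_G Lambda (F (cst 1)).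
  apply/funext => y; rewrite mixture_FE; apply: eq_integral => th _.
  by rewrite mul1r.
have mm : measurable_fun setT mixture.
  by rewrite mixE; apply: measurable_fubini_G; exact: iF.
apply/integrableP; split => //.
have := (integrable21ltyP Lambda mu (mF D1.1)).1 (iF D1).
apply: le_lt_trans; apply: ge0_le_integral => //.
- by apply: measurableT_comp.
- apply: (measurable_fun_fubini_tonelli_G (abse \o F (cst 1))) => //=.
  by apply: measurableT_comp => //; exact: mF D1.1.
- move=> y _; rewrite mixE; apply: le_abse_integral => //.
  by apply: measurableT_comp => //; exact: mF D1.1.
Qed.

Lemma mixture_ae_fin_num : {ae mu, forall y, mixture y \is a fin_num}.
Proof.
by have := integrable_ae measurableT mixture_integrable; apply: filterS => y /(_ I).
Qed.

Lemma fine_mixture_integrable : mu.-integrable setT (EFin \o (fine \o mixture)).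
Proof.
have /integrableP[mm mfin] := mixture_integrable.
have mfm : measurable_fun setT (EFin \o (fine \o mixture)).
  by apply/measurable_EFinP; apply: (measurableT_comp (fine_measurable measurableT)).
apply/integrableP; split => //; rewrite (ae_eq_integral (abse \o mixture))//.
- exact: measurableT_comp.
- exact: measurableT_comp.
- by apply: filterS mixture_ae_fin_num => y /= yfin _; rewrite -[in RHS](fineK yfin).
Qed.

(** A rule integrates against the mixture to the average of its rejection
    probabilities; the problem linearized at an optimal rule thereby becomes a
    testing problem between two fixed functions of y. *)
Lemma mixture_fubini (delta : Y -> R) : Delta delta ->
  \int[mu]_y (delta y * fine (mixture y)) =
  \int[Lambda]_(th in T) (c th * p th delta).
Proof.
move=> Dd; congr fine; rewrite [RHS]integral_mkcond.
transitivity (\int[Lambda]_th fubini_F mu (F delta) th)%E; last first.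
  apply: eq_integral => th _; by rewrite fubini_FE.
transitivity (\int[mu]_y fubini_G Lambda (F delta) y)%E; last first.
  exact: esym (Fubini (iF Dd)).
have mm := measurable_int _ fine_mixture_integrable.
apply: ae_eq_integral => //.
- by apply/measurable_EFinP/measurable_funM; [exact: Dd.1|exact/measurable_EFinP].
- by apply: measurable_fubini_G; exact: iF.
have D1 : Delta (cst 1 : Y -> R) by apply: Delta_cst; rewrite lexx ler01.
apply: filterS2 mixture_ae_fin_num (ae_integrable2 (iF D1)) => y /= yfin yi _.
rewrite EFinM fineK// -/(fubini_G Lambda (F delta) y) mixture_FE.
under [RHS]eq_integral => th _ do rewrite EFinM.
rewrite integralZl//; apply/(integrable_mkcond _ mT).
move: yi; apply: eq_integrable => // th _.
rewrite FE; rewrite !patchE; case: ifP => // _; by rewrite mul1r.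
Qed.

End mixture.

(** * The Neyman-Pearson lemma, necessity *)

(** It suffices to test h against the indicators of the two sets on which q
    vanishes and h is positive, respectively negative. *)
Lemma ae_eq0_of_null_tests (R : realType) (d : measure_display)
    (Y : measurableType d) (mu : {measure set Y -> \bar R}) (h q : Y -> R) :
  mu.-integrable setT (EFin \o h) -> measurable_fun setT q ->
  (forall e : Y -> R, Delta e -> (forall y, e y * q y = 0) ->
    \int[mu]_y (e y * h y) = 0) ->
  {ae mu, forall y, q y = 0 -> h y = 0}.
Proof.
move=> ih mq null_h.
have mh : measurable_fun setT h by apply/measurable_EFinP; exact: measurable_int ih.
have mN : measurable [set y | q y = 0].
  by rewrite -[X in measurable X]setTI; exact: (mq measurableT [set 0]).
pose Npos := [set y | q y = 0] `&` [set y | 0 < h y].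
pose Nneg := [set y | q y = 0] `&` [set y | h y < 0].
have mNpos : measurable Npos by apply: measurableI => //; exact: measurable_lt_set.
have mNneg : measurable Nneg by apply: measurableI => //; exact: measurable_lt_set.
have iA A : measurable A -> mu.-integrable setT (EFin \o (fun y => \1_A y * h y)).
  move=> mA; apply: (integrable_bounded_mul (M := 1)) => //.
  by move=> y _; apply: Delta_norm; exact: Delta_indic.
have null_N A : measurable A -> A `<=` [set y | q y = 0] ->
    \int[mu]_y (\1_A y * h y) = 0.
  move=> mA AN; apply: null_h; first exact: Delta_indic.
  move=> y; rewrite indicE; case: (boolP (y \in A)) => [/set_mem/AN ->|_].
    by rewrite mulr0.
  by rewrite mul0r.
have pos0 : {ae mu, forall y, setT y -> \1_Npos y * h y = 0}.
  apply: Rintegral_ge0_eq0 => //; first exact: iA.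
  - move=> y _; rewrite indicE; case: (boolP (y \in Npos)) => [/set_mem[_ /= ?]|_].
      by rewrite mul1r ltW.
    by rewrite mul0r.
  - by apply: null_N => //; exact: subIsetl.
have neg0 : {ae mu, forall y, setT y -> - (\1_Nneg y * h y) = 0}.
  apply: Rintegral_ge0_eq0 => //.
  - by have := integrableN (iA _ mNneg); exact: eq_integrable.
  - move=> y _; rewrite indicE; case: (boolP (y \in Nneg)) => [/set_mem[_ /= ?]|_].
      by rewrite mul1r oppr_ge0 ltW.
    by rewrite mul0r oppr0.
  - under eq_Rintegral => y _ do rewrite -mulN1r.
    by rewrite RintegralZl//; [rewrite null_N ?mulr0//; exact: subIsetl|exact: iA].
apply: filterS2 pos0 neg0 => y /= /(_ I) hpos /(_ I) hneg qy.
have [hlt|hgt|//] := ltgtP (h y) 0.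
- by move/eqP: hneg; rewrite indicE mem_set ?mul1r ?oppr_eq0// => /eqP.
- by move: hpos; rewrite indicE mem_set ?mul1r.
Qed.

Section neyman_pearson.
Context (R : realType) (d : measure_display) (Y : measurableType d).
Variables (mu : {measure set Y -> \bar R}) (h q delta : Y -> R).
Hypothesis ih : mu.-integrable setT (EFin \o h).
Hypothesis iq : mu.-integrable setT (EFin \o q).
Hypothesis q0 : forall y, 0 <= q y.
Hypothesis q1 : \int[mu]_y q y = 1.
Hypothesis hq : {ae mu, forall y, q y = 0 -> h y = 0}.
Hypothesis Ddelta : Delta delta.
Hypothesis delta_opt : forall delta' : Y -> R, Delta delta' ->
  \int[mu]_y (delta' y * q y) = \int[mu]_y (delta y * q y) ->
  \int[mu]_y (delta' y * h y) <= \int[mu]_y (delta y * h y).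

Let mh : measurable_fun setT h.
Proof. by apply/measurable_EFinP; exact: measurable_int ih. Qed.

Let mq : measurable_fun setT q.
Proof. by apply/measurable_EFinP; exact: measurable_int iq. Qed.

Let mul_integrable (a w : Y -> R) : Delta a -> mu.-integrable setT (EFin \o w) ->
  mu.-integrable setT (EFin \o (fun y => a y * w y)).
Proof.
move=> Da iw; apply: (integrable_bounded_mul (M := 1)) => //; first exact: Da.1.
by move=> y _; exact: Delta_norm.
Qed.

Let swap_value (a b w : Y -> R) (u v : R) : Delta a -> Delta b ->
  mu.-integrable setT (EFin \o w) ->
  \int[mu]_y ((delta y + v * a y - u * b y) * w y) =
  \int[mu]_y (delta y * w y) + v * \int[mu]_y (a y * w y)
    - u * \int[mu]_y (b y * w y).
Proof.
move=> Da Db iw.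
have iZ c e : Delta e -> mu.-integrable setT (EFin \o (fun y => c * (e y * w y))).
  by move=> De; have := integrableZl measurableT c (mul_integrable De iw); exact: eq_integrable.
rewrite -!RintegralZl//; [|exact: mul_integrable..].
rewrite -RintegralD//; [|exact: mul_integrable|exact: iZ].
rewrite -RintegralB//; [|
  by have := integrableD measurableT (mul_integrable Ddelta iw) (iZ v a Da); exact: eq_integrable
  |exact: iZ].
by apply: eq_Rintegral => y _; ring.
Qed.

(** If rejecting more where h > c q and rejecting less where h < c q were both
    possible, the two changes could be balanced so that the size is kept while
    the value increases. *)
Let swap c : {ae mu, forall y, c * q y < h y -> delta y = 1} \/
             {ae mu, forall y, h y < c * q y -> delta y = 0}.
Proof.
have [md d01] := Ddelta.
have mcq : measurable_fun setT (fun y => c * q y) by exact: measurable_funM.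
have mA : measurable [set y | c * q y < h y] by exact: measurable_lt_set.
have mB : measurable [set y | h y < c * q y] by exact: measurable_lt_set.
pose a y : R := (c * q y < h y)%R%:R * (1 - delta y).
pose b y : R := (h y < c * q y)%R%:R * delta y.
have Da : Delta a.
  split=> [|y]; last first.
    by have /andP[? ?] := d01 y; rewrite /a; case: ltP => _ /=; apply/andP; split; lra.
  apply: measurable_funM; last exact: measurable_funB.
  have := measurable_indic mA (R := R) (D := setT).
  by congr measurable_fun; apply/funext => y; rewrite indicE/= mem_setE.
have Db : Delta b.
  split=> [|y]; last first.
    by have /andP[? ?] := d01 y; rewrite /b; case: ltP => _ /=; apply/andP; split; lra.
  apply: measurable_funM => //.
  have := measurable_indic mB (R := R) (D := setT).
  by congr measurable_fun; apply/funext => y; rewrite indicE/= mem_setE.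
(* moving by v along a and by - u along b keeps the size; u and v lie in
   [0, 1], so the result is still a rule *)
pose u := \int[mu]_y (a y * q y); pose v := \int[mu]_y (b y * q y).
have unit_int e : Delta e -> 0 <= \int[mu]_y (e y * q y) <= 1.
  move=> De; apply/andP; split.
    by apply: Rintegral_ge0 => y _; rewrite mulr_ge0//; have /andP[] := De.2 y.
  rewrite -[leRHS]q1; apply: le_Rintegral => //; first exact: mul_integrable.
  by move=> y _; rewrite ler_piMl//; have /andP[] := De.2 y.
have /andP[u0 u1] : 0 <= u <= 1 by exact: unit_int.
have /andP[v0 v1] : 0 <= v <= 1 by exact: unit_int.
have Dd' : Delta (fun y => delta y + v * a y - u * b y).
  split=> [|y].
    apply: measurable_funB; last by apply: measurable_funM => //; exact: Db.1.
    by apply: measurable_funD => //; apply: measurable_funM => //; exact: Da.1.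
  have /andP[? ?] := d01 y; rewrite /a /b.
  by case: ltgtP => _ /=; apply/andP; split; nra.
have := delta_opt Dd'; rewrite !swap_value//.
rewrite -/u -/v mulrC addrK => /(_ erefl).
have icq : mu.-integrable setT (EFin \o (fun y => c * q y)).
  by have := integrableZl measurableT c iq; exact: eq_integrable.
have ihcq : mu.-integrable setT (EFin \o (fun y => h y - c * q y)).
  by have := integrableB measurableT ih icq; exact: eq_integrable.
have excess e : Delta e -> \int[mu]_y (e y * (h y - c * q y)) =
    \int[mu]_y (e y * h y) - c * \int[mu]_y (e y * q y).
  move=> De; rewrite -RintegralZl//; last exact: mul_integrable.
  rewrite -RintegralB//; last 2 first.
  - exact: mul_integrable.
  - by have := integrableZl measurableT c (mul_integrable De iq); exact: eq_integrable.
  by apply: eq_Rintegral => y _; ring.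
have := excess _ Da; have := excess _ Db; rewrite -/u -/v.
set Ga := \int[mu]_y (a y * (h y - _)); set Gb := \int[mu]_y (b y * (h y - _)).
move=> GbE GaE gain.
have a_ge0 y : 0 <= a y * (h y - c * q y).
  rewrite /a; have /andP[? ?] := d01 y.
  by case: ltP => hcq; rewrite /= ?mul1r ?mul0r//; apply: mulr_ge0; lra.
have b_ge0 y : 0 <= - (b y * (h y - c * q y)).
  rewrite /b; have /andP[? ?] := d01 y.
  case: ltP => hcq; rewrite /= ?mul1r ?mul0r ?oppr0// -mulrN.
  by apply: mulr_ge0; lra.
have iGb := mul_integrable Db ihcq.
have iNGb : mu.-integrable setT (EFin \o (fun y => - (b y * (h y - c * q y)))).
  by have := integrableN iGb; exact: eq_integrable.
have NGbE : \int[mu]_y (- (b y * (h y - c * q y))) = - Gb.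
  rewrite -mulN1r -RintegralZl//.
  by apply: eq_Rintegral => y _; rewrite mulN1r.
have Ga_ge0 : 0 <= Ga by apply: Rintegral_ge0 => y _; exact: a_ge0.
have Gb_le0 : 0 <= - Gb by rewrite -NGbE; apply: Rintegral_ge0 => y _; exact: b_ge0.
have [u_eq0|u_neq0] := eqVneq u 0; [left|right].
  have := Rintegral_ge0_eq0 measurableT (mul_integrable Da iq)
    (fun y _ => mulr_ge0 (andP (Da.2 y)).1 (q0 y)) u_eq0.
  apply: filterS2 hq => y /= hqy /(_ I)/eqP; rewrite mulf_eq0 => /orP[|/eqP qy0].
    rewrite /a => /[swap] ->; rewrite mul1r subr_eq0 => /eqP <-//.
  by rewrite hqy// qy0 mulr0 ltxx.
have Gb0 : - Gb = 0.
  have : u * - Gb <= 0 by nra.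
  by rewrite pmulr_rle0 ?lt_def ?u_neq0// => ?; lra.
have := Rintegral_ge0_eq0 measurableT iNGb (fun y _ => b_ge0 y) (etrans NGbE Gb0).
apply: filterS => y /= /(_ I)/eqP; rewrite oppr_eq0 /b => /[swap] hcq.
rewrite hcq mul1r mulf_eq0 => /orP[/eqP//|]; rewrite subr_eq0 => /eqP hE.
by move: hcq; rewrite hE ltxx.
Qed.

Hypothesis size_gt0 : 0 < \int[mu]_y (delta y * q y).
Hypothesis size_lt1 : \int[mu]_y (delta y * q y) < 1.

(** The threshold kappa is the infimum of the set K of levels c such that delta
    rejects almost surely where h > c q. By the exchange argument delta accepts
    almost surely where h < c q for every c outside K; K is neither empty nor
    unbounded below because the size of delta is neither 0 nor 1. *)
Lemma neyman_pearson_necessary : exists kappa : R,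
  {ae mu, forall y, (kappa * q y < h y -> delta y = 1) /\
                    (h y < kappa * q y -> delta y = 0)}.
Proof.
have [md d01] := Ddelta.
pose K := [set c : R | {ae mu, forall y, c * q y < h y -> delta y = 1}].
have L c : ~ K c -> {ae mu, forall y, h y < c * q y -> delta y = 0}.
  by move=> nKc; have [] := swap c.
have K_up c c' : c <= c' -> K c -> K c'.
  move=> cc'; apply: filterS => y /= + c'h; apply.
  by apply: le_lt_trans c'h; rewrite ler_wpM2r.
have nat_gt (x y : R) : 0 < y -> exists n : nat, x < n%:R * y.
  move=> y0; have := archi_boundP (normr_ge0 (x / y)) => xn.
  exists (Num.bound `|x / y|); rewrite -ltr_pdivrMr//.
  exact: le_lt_trans (ler_norm _) xn.
have K_neq0 : K !=set0.
  apply: contrapT => K0.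
  have Ln (n : nat) : {ae mu, forall y, h y < n%:R * q y -> delta y = 0}.
    by apply: L => Kn; apply: K0; exists n%:R.
  have := size_gt0; rewrite (ae_eq_Rintegral (w := cst 0))//.
  - by rewrite /Rintegral integral0 ltxx.
  - exact: measurable_funM.
  - apply: filterS (ae_foralln Ln) => y /= Lny _.
    have := q0 y; rewrite le_eqVlt => /predU1P[<-|/nat_gt-/(_ (h y))[n hn]].
      by rewrite mulr0.
    by rewrite (Lny n)// mul0r.
have K_lb : has_lbound K.
  apply: contrapT => K_unb.
  have Kn (n : nat) : K (- n%:R).
    apply: contrapT => nKn; apply: K_unb; exists (- n%:R) => c Kc.
    rewrite leNgt; apply/negP => cn; apply: nKn; apply: K_up Kc; exact: ltW.
  have := size_lt1; rewrite -q1 (ae_eq_Rintegral (w := q))//.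
  - by rewrite ltxx.
  - exact: measurable_funM.
  - apply: filterS (ae_foralln Kn) => y /= Kny _.
    have := q0 y; rewrite le_eqVlt => /predU1P[<-|/nat_gt-/(_ (- h y))[n hn]].
      by rewrite mulr0.
    by rewrite (Kny n) ?mul1r//; rewrite mulNr ltrNl.
pose kappa := inf K; exists kappa.
have above (n : nat) : {ae mu, forall y, (kappa + n.+1%:R^-1) * q y < h y -> delta y = 1}.
  have n0 : 0 < n.+1%:R^-1 :> R by rewrite invr_gt0.
  have [c Kc /ltW cn] := inf_adherent n0 (conj K_neq0 K_lb).
  exact: K_up Kc.
have below (n : nat) : {ae mu, forall y, h y < (kappa - n.+1%:R^-1) * q y -> delta y = 0}.
  apply: L => Kc; have := ge_inf K_lb Kc.
  by rewrite -/kappa lerBrDr gerDl leNgt invr_gt0 ltr0Sn.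
have small (x y : R) : 0 <= x -> 0 < y -> exists n : nat, n.+1%:R^-1 * x < y.
  move=> x0 y0; have xy0 : 0 < y / (x + 1) by rewrite divr_gt0//; lra.
  have [N _ NP] := near_infty_natSinv_lt (PosNum xy0).
  exists N; have := NP N (leqnn N); rewrite /= ltr_pdivlMr; last lra.
  have : 0 < N.+1%:R^-1 :> R by rewrite invr_gt0.
  by move: (N.+1%:R^-1) => z z0; nra.
apply: filterS2 (ae_foralln above) (ae_foralln below) => y /= aboveY belowY.
split=> hk.
- have hk0 : 0 < h y - kappa * q y by lra.
  have [n hn] := small _ _ (q0 y) hk0.
  apply: (aboveY n); move: (n.+1%:R^-1) hn => z hn; lra.
- have hk0 : 0 < kappa * q y - h y by lra.
  have [n hn] := small _ _ (q0 y) hk0.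
  apply: (belowY n); move: (n.+1%:R^-1) hn => z hn; lra.
Qed.

End neyman_pearson.

(** * The function g and the first variation of the objective *)

Section utility.
Context (R : realType) (g : R -> R).
Hypothesis g_C1 : assumption_A2 g.

Lemma utility_continuous : {within `[0, 1], continuous g}.
Proof. exact: derivable_oo_LRcontinuous_within g_C1.1. Qed.

Lemma utility_bounded : exists M : R, forall x, 0 <= x <= 1 -> `|g x| <= M.
Proof.
have [c _ gc] := EVT_max ler01 utility_continuous.
have [c' _ gc'] := EVT_min ler01 utility_continuous.
exists (Num.max (g c) (- g c')) => x x01.
have xI : x \in `[0, 1] by rewrite in_itv.
rewrite ler_norml lerNl le_max lerN2 gc'// orbT/=.
by rewrite le_max gc.
Qed.

Lemma utility_is_derive (x : R) : 0 < x < 1 -> is_derive x 1 g (g^`()%classic x).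
Proof.
move=> x01; rewrite derive1E; apply: DeriveDef => //.
by have [+ _ _] := g_C1.1; apply; rewrite in_itv.
Qed.

Lemma utility_MVT (x y : R) : 0 <= x -> x < y -> y <= 1 ->
  exists2 c, x < c < y & g y - g x = g^`()%classic c * (y - x).
Proof.
move=> x0 xy y1.
have gd c : c \in `]x, y[ -> is_derive c 1 g (g^`()%classic c).
  rewrite in_itv/= => /andP[xc cy]; apply: utility_is_derive.
  by rewrite (le_lt_trans x0 xc) (lt_le_trans cy y1).
have gc : {within `[x, y], continuous g}.
  apply: continuous_subspaceW utility_continuous => z /=.
  by rewrite !in_itv/= => /andP[? ?]; apply/andP; split; lra.
by have [c] := MVT xy gd gc; rewrite in_itv/=; exists c.
Qed.

Lemma utility_secant (x y : R) : 0 < x < 1 -> 0 < y < 1 ->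
  exists c, (x <= c <= y \/ y <= c <= x) /\
    g y - g x = g^`()%classic c * (y - x).
Proof.
move=> /andP[x0 x1] /andP[y0 y1]; have [xy|yx|<-] := ltgtP x y.
- have [c /andP[xc cy] gE] := utility_MVT (ltW x0) xy (ltW y1).
  by exists c; split => //; left; rewrite !ltW.
- have [c /andP[yc cx] gE] := utility_MVT (ltW y0) yx (ltW x1).
  exists c; split; first by right; rewrite !ltW.
  by rewrite -[LHS]opprK opprB gE -mulrN opprB.
- by exists x; split; [left; rewrite lexx|rewrite !subrr mulr0].
Qed.

Lemma utility_deriv_bounded (a b : R) : 0 < a -> a <= b -> b < 1 ->
  exists M : R, forall x, a <= x <= b -> `|g^`()%classic x| <= M.
Proof.
move=> a0 ab b1.
have cg' : {within `[a, b], continuous (fun x => `|g^`()%classic x|)}.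
  apply: continuous_in_subspaceT => x; rewrite inE/= in_itv/= => /andP[ax xb].
  apply: continuous_comp; last exact: norm_continuous.
  by apply: g_C1.2; rewrite in_itv/=; apply/andP; split; lra.
have [c _ gc] := EVT_max ab cg'.
by exists (`|g^`()%classic c|) => x xab; apply: gc; rewrite in_itv.
Qed.

Lemma utility_deriv_measurable : measurable_fun (`]0, 1[%classic : set R) g^`()%classic.
Proof.
apply: open_continuous_measurable_fun; first exact: interval_open.
by move=> x /set_mem; exact: g_C1.2.
Qed.

Lemma utility_increasing : (forall t, 0 < t < 1 -> 0 < g^`()%classic t) ->
  forall x y : R, 0 <= x -> x < y -> y <= 1 -> g x < g y.
Proof.
move=> g'0 x y x0 xy y1; have [c /andP[xc cy] gE] := utility_MVT x0 xy y1.
rewrite -subr_gt0 gE mulr_gt0 ?subr_gt0// g'0//.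
by rewrite (le_lt_trans x0 xc) (lt_le_trans cy y1).
Qed.

End utility.

Section first_variation.
Context (R : realType) (d : measure_display) (X : measurableType d).
Variables (Lambda : probability X R) (T : set X) (g : R -> R).
Hypothesis mT : measurable T.
Hypothesis g_C1 : assumption_A2 g.
Hypothesis mg : measurable_fun (`[0, 1]%classic : set R) g.
Variables (u v : X -> R) (a b : R).
Hypothesis meas_u : measurable_fun T u.
Hypothesis meas_v : measurable_fun T v.
Hypothesis a0 : 0 < a.
Hypothesis b1 : b < 1.
Hypothesis uab : forall x, T x -> a <= u x <= b.
Hypothesis v01 : forall x, T x -> 0 <= v x <= 1.

Lemma utility_comp_measurable (w : X -> R) : measurable_fun T w ->
  (forall x, T x -> 0 <= w x <= 1) -> measurable_fun T (g \o w).
Proof.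
move=> mw w01; apply: (measurable_comp _ _ mg mw) => //.
by move=> _ [x Tx <-] /=; rewrite in_itv/=; exact: w01.
Qed.

Lemma utility_comp_integrable (w : X -> R) : measurable_fun T w ->
  (forall x, T x -> 0 <= w x <= 1) -> Lambda.-integrable T (EFin \o (g \o w)).
Proof.
move=> mw w01; have [M gM] := utility_bounded g_C1.
apply: measurable_bounded_integrable => //.
- by rewrite (le_lt_trans (probability_le1 _ mT))// ltry.
- exact: utility_comp_measurable.
- by apply: (bounded_on (M := M)) => x Tx; apply: gM; exact: w01.
Qed.

Lemma marginal_utility_measurable : measurable_fun T (g^`()%classic \o u).
Proof.
apply: (measurable_comp _ _ (utility_deriv_measurable g_C1) meas_u) => //.
move=> _ [x Tx <-] /=; have /andP[au ub] := uab Tx.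
by rewrite in_itv/= (lt_le_trans a0 au) (le_lt_trans ub b1).
Qed.

(** The difference quotients of the objective are nonpositive. They converge to
    the integrand by the mean value theorem, and are dominated because u stays in
    a compact subset of the open unit interval, where the derivative of g is
    bounded. *)
Lemma first_variation_le0 :
  (forall t, 0 < t < 1 -> \int[Lambda]_(x in T) g (u x + t * (v x - u x)) <=
                          \int[Lambda]_(x in T) g (u x)) ->
  \int[Lambda]_(x in T) (g^`()%classic (u x) * (v x - u x)) <= 0.
Proof.
have [a_gt0 b_lt1] := (a0, b1).
move=> u_max; have [Te|/set0P[x0 Tx0]] := eqVneq T set0.
  by rewrite Te Rintegral_set0.
have ab : a <= b by have /andP[] := uab Tx0; exact: le_trans.
(* u + t (v - u) stays in [a / 2, (b + 1) / 2] for t <= 1 / 2 *)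
have [M g'M] : exists M : R, forall x, a / 2 <= x <= (b + 1) / 2 ->
    `|g^`()%classic x| <= M.
  by apply: (utility_deriv_bounded g_C1); lra.
pose t n : R := n.+2%:R^-1.
have t0 n : 0 < t n by rewrite invr_gt0.
have t12 n : t n <= 1 / 2 by rewrite div1r lef_pV2 ?posrE// ler_nat.
pose ut n x := u x + t n * (v x - u x).
have ut_in n x : T x -> a / 2 <= ut n x <= (b + 1) / 2.
  move=> Tx; have /andP[? ?] := uab Tx; have /andP[? ?] := v01 Tx.
  have := t0 n; have := t12 n; rewrite /ut; move: (t n) => z ? ?.
  by apply/andP; split; nra.
pose G n x := (t n)^-1 * (g (ut n x) - g (u x)).
have mut n : measurable_fun T (ut n).
  by apply: measurable_funD => //; apply: measurable_funM => //; exact: measurable_funB.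
have secant n x : T x -> exists c, [/\ `|g^`()%classic c| <= M,
    `|c - u x| <= t n & G n x = g^`()%classic c * (v x - u x)].
  move=> Tx; have := ut_in n x Tx; have /andP[ua ub] := uab Tx => /andP[uta utb].
  have [||c [cu gE]] := @utility_secant R g g_C1 (u x) (ut n x).
  - by apply/andP; split; lra.
  - by apply/andP; split; lra.
  have utE : ut n x - u x = t n * (v x - u x) by rewrite /ut addrC addKr.
  exists c; split => //.
  - by apply: g'M; case: cu => /andP[? ?]; apply/andP; split; lra.
  - apply: (@le_trans _ _ `|ut n x - u x|).
      case: cu => /andP[? ?]; first by rewrite !ger0_norm; lra.
      by rewrite !ler0_norm; lra.
    rewrite utE normrM (ger0_norm (ltW (t0 n))) ler_piMr ?(ltW (t0 n))//.
    by have /andP[? ?] := v01 Tx; rewrite ler_norml; apply/andP; split; lra.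
  - by rewrite /G gE utE mulrCA mulKf// gt_eqF.
have GM n x : T x -> `|G n x| <= M.
  move=> Tx; have [c [cM _ ->]] := secant n x Tx; rewrite normrM.
  rewrite -[leRHS]mulr1 ler_pM//; have /andP[? ?] := uab Tx.
  by have /andP[? ?] := v01 Tx; rewrite ler_norml; apply/andP; split; lra.
have u01 x : T x -> 0 <= u x <= 1.
  by move=> /uab /andP[? ?]; apply/andP; split; lra.
have ut01 n x : T x -> 0 <= ut n x <= 1.
  by move=> /(ut_in n) /andP[? ?]; apply/andP; split; lra.
have iu := utility_comp_integrable meas_u u01.
have iut n := utility_comp_integrable (mut n) (ut01 n).
have mG n : measurable_fun T (G n).
  apply: measurable_funM => //.
  apply: measurable_funB; first exact: (utility_comp_measurable (mut n) (ut01 n)).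
  exact: (utility_comp_measurable meas_u u01).
have Gle0 n : \int[Lambda]_(x in T) G n x <= 0.
  rewrite RintegralZl//; last first.
    by have := integrableB mT (iut n) iu; exact: eq_integrable.
  rewrite RintegralB//; last exact: iut.
  rewrite pmulr_rle0 ?invr_gt0// subr_le0; apply: u_max.
  by rewrite t0/=; have := t12 n; lra.
have iM : Lambda.-integrable T (EFin \o cst M).
  apply: measurable_bounded_integrable => //.
    by rewrite (le_lt_trans (probability_le1 _ mT))// ltry.
  exact: (bounded_on (M := `|M|)).
have Gcvg : \int[Lambda]_(x in T) G n x @[n --> \oo] -->
    \int[Lambda]_(x in T) (g^`()%classic (u x) * (v x - u x)).
  apply: (Rintegral_dominated_cvg mT mG _ _ iM) => //.
    apply: measurable_funM; first exact: marginal_utility_measurable.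
    exact: measurable_funB.
  apply: aeW => x Tx; have [c cP] := choice (fun n => secant n x Tx).
  under eq_fun => n do have [_ _ ->] := cP n.
  apply: cvgMl; have cu : c n @[n --> \oo] --> u x.
    apply/cvgrPdist_le => e e0; have [N _ NP] := near_infty_natSinv_lt (PosNum e0).
    exists N => // n /NP /= /ltW ne; rewrite distrC.
    have [_ cn _] := cP n; apply: le_trans cn (le_trans _ ne).
    by rewrite /t lef_pV2 ?posrE// ler_nat.
  apply: (cvg_comp _ _ cu); apply: g_C1.2.
  by have /andP[? ?] := uab Tx; rewrite in_itv/=; apply/andP; split; lra.
apply: (cvgr_to_le Gcvg); exact: nearW.
Qed.

End first_variation.

(** * Averages over the parameters *)

Section averages.
Context (R : realType) (d : measure_display) (X : measurableType d).
Variables (Lambda : probability X R) (T : set X).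
Hypothesis mT : measurable T.
Hypothesis LambdaT : Lambda T = 1%E.

Lemma average_cst (c : R) : \int[Lambda]_(x in T) c = c.
Proof. by rewrite Rintegral_cst//= LambdaT /= mulr1. Qed.

Lemma bounded_average_integrable (h : X -> R) (M : R) : measurable_fun T h ->
  (forall x, T x -> `|h x| <= M) -> Lambda.-integrable T (EFin \o h).
Proof.
move=> mh hM; apply: measurable_bounded_integrable => //; last exact: bounded_on hM.
by rewrite (le_lt_trans (probability_le1 _ mT))// ltry.
Qed.

Lemma average_gt0 (h : X -> R) : Lambda.-integrable T (EFin \o h) ->
  (forall x, T x -> 0 < h x) -> 0 < \int[Lambda]_(x in T) h x.
Proof.
move=> ih h0; rewrite lt_def Rintegral_ge0 ?andbT; last by move=> x /h0/ltW.
apply/eqP => ih0.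
have [N [mN N0 NT]] := Rintegral_ge0_eq0 mT ih (fun x Tx => ltW (h0 x Tx)) ih0.
have TN : T `<=` N.
  by move=> x Tx; apply: NT => /= /(_ Tx) hx0; have := h0 x Tx; rewrite hx0 ltxx.
have : (Lambda T <= Lambda N)%E by apply: le_measure; rewrite ?inE.
by rewrite LambdaT N0 lee_fin leNgt ltr01.
Qed.

Lemma lt_average (h k : X -> R) : Lambda.-integrable T (EFin \o h) ->
  Lambda.-integrable T (EFin \o k) -> (forall x, T x -> h x < k x) ->
  \int[Lambda]_(x in T) h x < \int[Lambda]_(x in T) k x.
Proof.
move=> ih ik hk; rewrite -subr_gt0 -RintegralB//; apply: average_gt0.
  by have := integrableB mT ik ih; exact: eq_integrable.
by move=> x Tx; rewrite subr_gt0; exact: hk.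
Qed.

End averages.

(** * Optimal rules *)

Section problem.
Context (R : realType) (d1 : nat) (dY : measure_display) (Y : measurableType dY).
Variables (mu : {sigma_finite_measure set Y -> \bar R}) (f : 'rV[R]_d1 -> Y -> R).
Variables Theta Theta0 Theta1 : set 'rV[R]_d1.
Variables Lambda0 Lambda1 : probability (borel_rV R d1) R.
Variables (g : R -> R) (alpha : R).
Hypothesis Theta_compact : compact Theta.
Hypothesis mTheta0 : measurable (Theta0 : set (borel_rV R d1)).
Hypothesis Theta0_sub : Theta0 `<=` Theta.
Hypothesis Theta1E : Theta1 = Theta `\` Theta0.
Hypothesis Theta0_neq0 : Theta0 !=set0.
Hypothesis f_density : density_family mu f Theta.
Hypothesis alpha01 : 0 < alpha < 1.
Hypothesis mg : measurable_fun (`[0, 1]%classic : set R) g.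
Hypothesis Lambda0_on : Lambda0 Theta0 = 1%E.
Hypothesis Lambda1_on : Lambda1 Theta1 = 1%E.
Hypothesis f_A1 : assumption_A1 mu f Theta.
Hypothesis g_C1 : assumption_A2 g.
Local Notation p := (reject_prob mu f).
Local Notation J := (objective mu f Theta1 Lambda1 g).
Local Notation size_ := (avg_size mu f Theta0 Lambda0).
Local Notation feas := (feasible mu f Theta0 Lambda0 alpha).
Local Notation opt := (optimal mu f Theta0 Theta1 Lambda0 Lambda1 g alpha).

Let mTheta : measurable (Theta : set (borel_rV R d1)).
Proof. exact: compact_measurable_rV. Qed.

Let mTheta1 : measurable (Theta1 : set (borel_rV R d1)).
Proof. by rewrite Theta1E; exact: measurableD. Qed.

Let Theta1_sub : Theta1 `<=` Theta.
Proof. by rewrite Theta1E; exact: subDsetl. Qed.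

Let mp (T : set 'rV[R]_d1) (delta : Y -> R) :
  measurable (T : set (borel_rV R d1)) -> T `<=` Theta -> Delta delta ->
  measurable_fun (T : set (borel_rV R d1)) (p ^~ delta : borel_rV R d1 -> R).
Proof.
move=> mT TTheta Dd; apply: within_continuous_measurable_rV => //.
apply: continuous_subspaceW TTheta _.
exact: (reject_prob_continuous f_density f_A1.1).
Qed.

Let p01 th (delta : Y -> R) : Theta th -> Delta delta -> 0 <= p th delta <= 1.
Proof. exact: reject_prob01. Qed.

Let p_norm th (delta : Y -> R) : Theta th -> Delta delta -> `|p th delta| <= 1.
Proof. by move=> Th Dd; have /andP[? ?] := p01 Th Dd; rewrite ger0_norm. Qed.

Let ip0 (delta : Y -> R) : Delta delta ->
  Lambda0.-integrable Theta0 (EFin \o (p ^~ delta)).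
Proof.
move=> Dd; apply: (bounded_average_integrable _ _ (M := 1)) => //; first exact: mp.
by move=> th /Theta0_sub Th; exact: p_norm.
Qed.

Let igp (delta : Y -> R) : Delta delta ->
  Lambda1.-integrable Theta1 (EFin \o (g \o (p ^~ delta))).
Proof.
move=> Dd; apply: utility_comp_integrable => //; first exact: mp.
by move=> th /Theta1_sub Th; exact: p01.
Qed.

Let D0 : Delta (fun _ : Y => 0 : R).
Proof. by apply: Delta_cst; rewrite lexx ler01. Qed.

Lemma avg_size_segment (a b : Y -> R) (t : R) : Delta a -> Delta b ->
  size_ (fun y => a y + t * (b y - a y)) = size_ a + t * (size_ b - size_ a).
Proof.
move=> Da Db; rewrite /avg_size -RintegralB//; [|exact: ip0..].
have iB : Lambda0.-integrable Theta0 (EFin \o (fun th => p th b - p th a)).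
  by have := integrableB mTheta0 (ip0 Db) (ip0 Da); exact: eq_integrable.
rewrite -RintegralZl// -RintegralD//; [|exact: ip0|
  by have := integrableZl mTheta0 t iB; exact: eq_integrable].
apply: eq_Rintegral => th /set_mem /Theta0_sub Th.
exact: (reject_prob_segment f_density).
Qed.

Lemma avg_size_cst (t : R) : size_ (fun=> t) = t.
Proof.
rewrite /avg_size -[RHS](average_cst mTheta0 Lambda0_on).
apply: eq_Rintegral => th /set_mem /Theta0_sub Th.
exact: (reject_prob_cst f_density).
Qed.

Lemma feasible0 : feas (fun=> 0).
Proof. by split => //; rewrite avg_size_cst; have /andP[/ltW] := alpha01. Qed.

(** Size and objective pass to the limit along a weakly convergent subsequence of
    a maximizing sequence, by dominated convergence in the parameter. *)
Lemma optimal_exists : exists delta, opt delta.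
Proof.
have [M gM] := utility_bounded g_C1.
have JM delta : Delta delta -> J delta <= M.
  move=> Dd; rewrite -(average_cst mTheta1 Lambda1_on M); apply: le_Rintegral => //.
  - exact: igp.
  - by apply: (bounded_average_integrable _ _ (M := `|M|)).
  - by move=> th /Theta1_sub Th; apply: le_trans (ler_norm _) (gM _ _); exact: p01.
pose V := [set J delta | delta in [set delta | feas delta]].
have V_sup : has_sup V.
  split; first by exists (J (fun=> 0)); exists (fun=> 0) => //; exact: feasible0.
  by exists M => _ [delta [Dd _] <-]; exact: JM.
have ex n : exists delta, feas delta /\ sup V - n.+1%:R^-1 < J delta.
  have n0 : 0 < n.+1%:R^-1 :> R by rewrite invr_gt0.
  by have [_ [delta fd <-] ?] := sup_adherent n0 V_sup; exists delta.
have [delta_ dP] := choice ex.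
have D_ n : Delta (delta_ n) by have [[]] := dP n.
have [phi [delta Dd [phik pcvg]]] :=
  rules_weakly_sequentially_compact f_density f_A1.2 Theta_compact f_A1.1 D_.
have size_cvg : size_ (delta_ (phi k)) @[k --> \oo] --> size_ delta.
  apply: (Rintegral_dominated_cvg (w := cst 1)) => //.
  - by move=> n; apply: mp.
  - exact: mp.
  - by apply: aeW => th /Theta0_sub; exact: pcvg.
  - by apply: (bounded_average_integrable _ _ (M := 1)) => // th _; rewrite normr1.
  - by move=> n th /Theta0_sub Th; exact: p_norm.
have J_cvg : J (delta_ (phi k)) @[k --> \oo] --> J delta.
  apply: (Rintegral_dominated_cvg (w := cst M)) => //.
  - by move=> n; apply/measurable_EFinP; exact: measurable_int (igp (D_ _)).
  - by apply/measurable_EFinP; exact: measurable_int (igp Dd).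
  - apply: aeW => th /Theta1_sub Th.
    apply: (cvg_within_seq (utility_continuous g_C1)); last exact: pcvg.
    + by move=> n /=; rewrite in_itv/=; exact: p01.
    + by rewrite /= in_itv/=; exact: p01.
  - by apply: (bounded_average_integrable _ _ (M := `|M|)).
  - by move=> n th /Theta1_sub Th; apply: gM; exact: p01.
exists delta; split.
  split => //; apply: (cvgr_to_le size_cvg); apply: nearW => k.
  by have [[_]] := dP (phi k).
move=> delta' fd'; apply: (@le_trans _ _ (sup V)).
  by apply: sup_upper_bound => //; exists delta'.
apply/ler_addgt0Pr => e e0; rewrite -lerBlDr.
apply: (cvgr_to_ge J_cvg); have [N _ NP] := near_infty_natSinv_lt (PosNum e0).
exists N => // k /= Nk; have [_ /ltW] := dP (phi k); apply: le_trans.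
rewrite lerD2l lerN2; apply/ltW; apply: NP => /=; exact: leq_trans Nk (phik k).
Qed.

Let eq_on_Theta (delta delta' : Y -> R) :
  (forall th, Theta th -> p th delta = p th delta') ->
  size_ delta = size_ delta' /\ J delta = J delta'.
Proof.
move=> pE; split; apply: eq_Rintegral => th /set_mem.
- by move=> /Theta0_sub /pE.
- by move=> /Theta1_sub /pE ->.
Qed.

(** If some rejection probability were 0 all of them would be, and delta would be
    no better than the zero rule; if some were 1 all of them would be, and the
    size would be 1, which exceeds alpha. *)
Lemma optimal_reject_prob_interior (delta : Y -> R) : ~ opt (fun=> 0) -> opt delta ->
  forall th, Theta th -> 0 < p th delta < 1.
Proof.
move=> n0 [[Dd sd] od] th Th; have /andP[p0 p1] := p01 Th Dd.
rewrite !lt_neqAle p0 p1 !andbT eq_sym; apply/andP; split; apply/eqP => pE.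
- apply: n0; split; first exact: feasible0.
  have [_ <-] : size_ delta = size_ (fun=> 0) /\ J delta = J (fun=> 0).
    apply: eq_on_Theta => th' Th'; rewrite (reject_prob_cst f_density)//.
    exact: (reject_prob_eq0 f_density f_A1.2 Th).
  exact: od.
- have [sE _] : size_ delta = size_ (fun=> 1) /\ J delta = J (fun=> 1).
    apply: eq_on_Theta => th' Th'; rewrite (reject_prob_cst f_density)//.
    exact: (reject_prob_eq1 f_density f_A1.2 Th).
  move: sd; rewrite sE avg_size_cst => a1.
  by have /andP[_] := alpha01; rewrite ltNge a1.
Qed.

Let interior (delta : Y -> R) := forall th, Theta th -> 0 < p th delta < 1.

(** By continuity on the compact set Theta, interior rejection probabilities stay
    away from 0 and 1. *)
Let p_range (delta : Y -> R) : Delta delta -> interior delta ->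
  exists a, exists b, [/\ 0 < a, b < 1 &
    forall th, Theta1 th -> a <= p th delta <= b].
Proof.
move=> Dd p_int.
have Theta_neq0 : Theta !=set0.
  by have [th th0] := Theta0_neq0; exists th; exact: Theta0_sub.
have cp := reject_prob_continuous f_density f_A1.1 Dd.
have [ta /set_mem Ta aP] := EVT_min_rV Theta_neq0 Theta_compact cp.
have [tb /set_mem Tb bP] := EVT_max_rV Theta_neq0 Theta_compact cp.
exists (p ta delta), (p tb delta); split.
- by have /andP[] := p_int _ Ta.
- by have /andP[] := p_int _ Tb.
- by move=> th /Theta1_sub Th; rewrite aP ?inE// bP ?inE.
Qed.

(** An optimal rule also maximizes the linearized objective among the rules of
    the same size, all of which can be reached along feasible segments. *)
Lemma optimal_first_order (delta delta' : Y -> R) : opt delta ->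
  (forall th, Theta th -> 0 < p th delta < 1) ->
  Delta delta' -> size_ delta' = size_ delta ->
  \int[Lambda1]_(th in Theta1)
     (g^`()%classic (p th delta) * (p th delta' - p th delta)) <= 0.
Proof.
move=> [[Dd sd] maxd] p_int Dd' sE.
have [a [b [a0 b1 pab]]] := p_range Dd p_int.
apply: (first_variation_le0 mTheta1 g_C1 mg (mp mTheta1 Theta1_sub Dd)
  (mp mTheta1 Theta1_sub Dd') a0 b1 pab) => [th /Theta1_sub Th|t /andP[t0 t1]].
  exact: p01.
have t01 : 0 <= t <= 1 by rewrite !ltW.
have := maxd (fun y => delta y + t * (delta' y - delta y)).
rewrite /objective; under eq_Rintegral => th /set_mem /Theta1_sub Th
  do rewrite (reject_prob_segment f_density)//.
apply; split; first exact: Delta_segment.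
by rewrite avg_size_segment// sE subrr mulr0 addr0.
Qed.

Let H (delta : Y -> R) (y : Y) := fine (Hmix1 mu f Theta1 Lambda1 g delta y).

Let q (y : Y) := fine (f_mix0 f Theta0 Lambda0 y).

Let f_mix0E : f_mix0 f Theta0 Lambda0 = mixture f Lambda0 Theta0 (cst 1).
Proof.
by apply/funext => y; apply: eq_integral => th _; rewrite mul1r.
Qed.

Let iq : mu.-integrable setT (EFin \o q).
Proof.
rewrite /q f_mix0E; apply: (fine_mixture_integrable f_density mTheta Lambda0 mTheta0
  Theta0_sub (c := cst 1) (M := 1)) => //.
by move=> th _; rewrite normr1.
Qed.

Let q_fin : {ae mu, forall y, f_mix0 f Theta0 Lambda0 y \is a fin_num}.
Proof.
rewrite f_mix0E; apply: (mixture_ae_fin_num f_density mTheta Lambda0 mTheta0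
  Theta0_sub (c := cst 1) (M := 1)) => //.
by move=> th _; rewrite normr1.
Qed.

Lemma avg_size_mixture (delta : Y -> R) : Delta delta ->
  \int[mu]_y (delta y * q y) = size_ delta.
Proof.
move=> Dd; rewrite /q f_mix0E (mixture_fubini f_density mTheta Lambda0 mTheta0
  Theta0_sub (c := cst 1) (M := 1))//.
  by apply: eq_Rintegral => th _; rewrite mul1r.
by move=> th _; rewrite normr1.
Qed.

Let mg' (delta : Y -> R) : Delta delta -> interior delta ->
  measurable_fun (Theta1 : set (borel_rV R d1))
    ((fun th => g^`()%classic (p th delta)) : borel_rV R d1 -> R).
Proof.
move=> Dd p_int; have [a [b [a0 b1 pab]]] := p_range Dd p_int.
exact: (marginal_utility_measurable g_C1 (mp mTheta1 Theta1_sub Dd) a0 b1 pab).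
Qed.

Let g'M (delta : Y -> R) : Delta delta -> interior delta ->
  exists M, forall th, Theta1 th -> `|g^`()%classic (p th delta)| <= M.
Proof.
move=> Dd p_int; have [a [b [a0 b1 pab]]] := p_range Dd p_int.
have [ab|ba] := leP a b.
  have [M MP] := utility_deriv_bounded g_C1 a0 ab b1.
  by exists M => th /pab; exact: MP.
exists 0 => th /pab /andP[ap pb].
by have := le_lt_trans (le_trans ap pb) ba; rewrite ltxx.
Qed.

(** The first order condition says that delta is a most powerful test of its size
    for the null mixture against H, so that the Neyman-Pearson lemma applies. *)
Lemma optimal_NP_form_ae (delta : Y -> R) : opt delta ->
  (forall th, Theta th -> 0 < p th delta < 1) ->
  exists kappa : R, {ae mu, forall y,
    NP_form mu f Theta0 Theta1 Lambda0 Lambda1 g delta delta kappa y}.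
Proof.
move=> od p_int; have [[Dd sd] maxd] := od.
have [M g'M1] := g'M Dd p_int.
have mg'1 := mg' Dd p_int.
have iH : mu.-integrable setT (EFin \o H delta).
  exact: (fine_mixture_integrable f_density mTheta Lambda1 mTheta1 Theta1_sub mg'1 g'M1).
have H_fubini (e : Y -> R) : Delta e -> \int[mu]_y (e y * H delta y) =
    \int[Lambda1]_(th in Theta1) (g^`()%classic (p th delta) * p th e).
  exact: (mixture_fubini f_density mTheta Lambda1 mTheta1 Theta1_sub mg'1 g'M1).
have q0 y : 0 <= q y.
  apply: fine_ge0; rewrite f_mix0E; apply: integral_ge0 => th /Theta0_sub Th.
  by rewrite lee_fin mul1r; have [_ + _] := f_density.1 _ Th; exact.
have q1 : \int[mu]_y q y = 1.
  rewrite -(avg_size_cst 1) -avg_size_mixture; last by apply: Delta_cst; rewrite lexx ler01.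
  by apply: eq_Rintegral => y _; rewrite mul1r.
have mq : measurable_fun setT q by apply/measurable_EFinP; exact: measurable_int iq.
(* a test of size zero under the null mixture has size zero everywhere *)
have null_H (e : Y -> R) : Delta e -> (forall y, e y * q y = 0) ->
    \int[mu]_y (e y * H delta y) = 0.
  move=> De eq0; rewrite H_fubini//.
  have [th [th0 pth0]] : exists th, Theta0 th /\ p th e = 0.
    apply: contrapT => npth.
    have : 0 < size_ e.
      apply: (average_gt0 mTheta0 Lambda0_on (ip0 De)).
      move=> th th0; have /andP[+ _] := p01 (Theta0_sub th0) De.
      by rewrite le_eqVlt => /predU1P[pE|//]; exfalso; apply: npth; exists th.
    by rewrite -avg_size_mixture// Rintegral_eq0 ?ltxx.
  apply: Rintegral_eq0 => th' /Theta1_sub Th'.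
  by rewrite (reject_prob_eq0 f_density f_A1.2 (Theta0_sub th0) Th' De)// mulr0.
have qH := ae_eq0_of_null_tests iH mq null_H.
have [|||kappa kappaP] := neyman_pearson_necessary iH iq q0 q1 qH Dd.
- move=> delta' Dd'; rewrite (avg_size_mixture Dd') (avg_size_mixture Dd).
  rewrite (H_fubini _ Dd') (H_fubini _ Dd) => sE.
  have := optimal_first_order od p_int Dd' sE.
  have ic (e : Y -> R) : Delta e -> Lambda1.-integrable Theta1
      (EFin \o (fun th => g^`()%classic (p th delta) * p th e)).
    move=> De; apply: (bounded_average_integrable _ mTheta1 (M := M)).
      apply: measurable_funM; [exact: mg'1|exact: mp].
    move=> th th1; rewrite normrM -[leRHS]mulr1.
    by apply: ler_pM => //; [exact: g'M1|exact: (p_norm (Theta1_sub th1) De)].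
  under eq_Rintegral => th _ do rewrite mulrBr.
  by rewrite (RintegralB mTheta1 (ic _ Dd') (ic _ Dd)) subr_le0.
- rewrite avg_size_mixture//; apply: average_gt0 => //; first exact: ip0.
  by move=> th /Theta0_sub Th; have /andP[] := p_int th Th.
- rewrite avg_size_mixture//; apply: le_lt_trans sd _.
  by have /andP[] := alpha01.
exists kappa.
have H_fin : {ae mu, forall y, Hmix1 mu f Theta1 Lambda1 g delta y \is a fin_num}.
  exact: (mixture_ae_fin_num f_density mTheta Lambda1 mTheta1 Theta1_sub mg'1 g'M1).
apply: filterS3 kappaP q_fin H_fin => y /= [k1 k0] qf Hf; split => //.
- by rewrite -(fineK qf) -(fineK Hf) -EFinM lte_fin; exact: k1.
- by rewrite -(fineK qf) -(fineK Hf) -EFinM lte_fin; exact: k0.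
Qed.

(** The exceptional null set is removed by redefining an optimal rule there; this
    changes no rejection probability, hence neither H nor optimality. *)
Lemma optimal_NP_form : ~ opt (fun=> 0) ->
  exists delta, exists kappa : R, opt delta /\ forall y,
    NP_form mu f Theta0 Theta1 Lambda0 Lambda1 g delta delta kappa y.
Proof.
move=> n0; have [delta od] := optimal_exists; have [[Dd sd] maxd] := od.
have p_int := optimal_reject_prob_interior n0 od.
have [kappa form] := optimal_NP_form_ae od p_int.
have [M g'M1] := g'M Dd p_int.
move=> {n0 od}.
pose Q y := (kappa%:E * f_mix0 f Theta0 Lambda0 y)%E.
pose H' := Hmix1 mu f Theta1 Lambda1 g delta.
have mQ : measurable_fun setT Q.
  rewrite /Q f_mix0E; apply: measurable_funeM; apply: measurable_int.
  apply: (mixture_integrable f_density mTheta Lambda0 mTheta0 Theta0_sub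
    (c := cst 1) (M := 1)) => //.
  by move=> th _; rewrite normr1.
have mH : measurable_fun setT H'.
  apply: measurable_int.
  exact: (mixture_integrable f_density mTheta Lambda1 mTheta1 Theta1_sub (mg' Dd p_int) g'M1).
pose delta_s y : R := if (Q y < H' y)%E then 1 else if (H' y < Q y)%E then 0 else delta y.
have Ds : Delta delta_s.
  split=> [|y]; last first.
    rewrite /delta_s; case: ifP => _; first by rewrite lexx ler01.
    by case: ifP => _; [rewrite lexx ler01|exact: Dd.2].
  apply: measurable_fun_ifT; [exact: (measurable_fun_lte mQ mH)|exact: measurable_cst|].
  apply: measurable_fun_ifT; [exact: (measurable_fun_lte mH mQ)|exact: measurable_cst|].
  exact: Dd.1.
have delta_sE : {ae mu, forall y, delta_s y = delta y}.
  apply: filterS form => y [f1 _ f0]; rewrite /delta_s.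
  by case: ifPn => [/f1 ->//|_]; case: ifPn => [/f0 ->|].
have psE th : Theta th -> p th delta_s = p th delta.
  move=> Th; have [mf _ _] := f_density.1 _ Th; apply: ae_eq_Rintegral => //.
  - by apply: measurable_funM => //; exact: Ds.1.
  - by apply: measurable_funM => //; exact: Dd.1.
  - by apply: filterS delta_sE => y ->.
have [sE JE] := eq_on_Theta psE.
have HE : Hmix1 mu f Theta1 Lambda1 g delta_s = H'.
  by apply/funext => y; apply: eq_integral => th /set_mem /Theta1_sub /psE ->.
exists delta_s, kappa; split.
  split; first by split; [exact: Ds|rewrite sE; exact: sd].
  rewrite JE; exact: maxd.
move=> {maxd sd} y; rewrite /NP_form HE -/(Q y) /delta_s.
split=> [->|_|QH]; [by []|by []|].
by rewrite QH (ltNge (Q y)) (ltW QH).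
Qed.

(** The constant rule alpha does better. *)
Lemma zero_rule_not_optimal :
  (forall t, 0 < t < 1 -> 0 < g^`()%classic t) -> ~ opt (fun=> 0).
Proof.
move=> g'0 [_ max0]; have /andP[a0 a1] := alpha01.
have Da : Delta (fun _ : Y => alpha) by apply: Delta_cst; rewrite !ltW.
have := max0 (fun=> alpha); rewrite leNgt => /(_ _)/negP; apply.
  by split; [exact: Da|rewrite avg_size_cst].
apply: (lt_average mTheta1 Lambda1_on (igp D0) (igp Da)).
move=> th /Theta1_sub Th; rewrite /= !(reject_prob_cst f_density _ Th).
exact: (utility_increasing g_C1 g'0 (lexx 0) a0 (ltW a1)).
Qed.

(** If there were slack, moving towards the rule 1 would raise every rejection
    probability strictly while remaining feasible. *)
Lemma optimal_exhausts_size (delta : Y -> R) :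
  (forall t, 0 < t < 1 -> 0 < g^`()%classic t) -> opt delta -> size_ delta = alpha.
Proof.
move=> g'0 od; have n0 := zero_rule_not_optimal g'0.
have p_int := optimal_reject_prob_interior n0 od; move=> {n0}.
have [[Dd sd] maxd] := od; apply/eqP; rewrite eq_le sd/= leNgt; apply/negP => s_lt.
have /andP[a0 a1] := alpha01.
have s0 : 0 <= size_ delta.
  by apply: Rintegral_ge0 => th /Theta0_sub Th; have /andP[] := p01 Th Dd.
(* the convex combination of delta and the rule 1 that has size alpha *)
pose t := (alpha - size_ delta) / (1 - size_ delta).
have s1 : 0 < 1 - size_ delta by lra.
have t0 : 0 < t by rewrite divr_gt0// subr_gt0.
have t01 : 0 <= t <= 1 by rewrite ltW//= ler_pdivrMr// mul1r; lra.
have D1 : Delta (fun _ : Y => 1 : R) by apply: Delta_cst; rewrite lexx ler01.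
pose delta' y := delta y + t * (1 - delta y).
have Dd' : Delta delta' by exact: (Delta_segment Dd D1).
have := maxd delta'; rewrite leNgt => /(_ _)/negP; apply.
  split; first exact: Dd'.
  rewrite (avg_size_segment t Dd D1) avg_size_cst /t.
  by rewrite divfK ?gt_eqF//; lra.
apply: (lt_average mTheta1 Lambda1_on (igp Dd) (igp Dd')).
move=> th /Theta1_sub Th; have /andP[p0 p1] := p_int _ Th.
have p'E : p th delta' = p th delta + t * (1 - p th delta).
  by rewrite (reject_prob_segment f_density t Th Dd D1) (reject_prob_cst f_density).
apply: (utility_increasing g_C1 g'0 (ltW p0)).
- by rewrite p'E ltrDl mulr_gt0// subr_gt0.
- by have /andP[] := p01 Th Dd'.
Qed.

End problem.

Theorem theorem8 (R : realType) (d1 d2 : nat)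
  (d1_ge1 : (1 <= d1)%N) (d2_ge1 : (1 <= d2)%N)
  (Theta Theta0 Theta1 : set 'rV[R]_d1)
  (Theta_compact : compact Theta)
  (Theta0_measurable : measurable (Theta0 : set (borel_rV R d1)))
  (Theta0_sub : Theta0 `<=` Theta)
  (Theta1E : Theta1 = Theta `\` Theta0)
  (Theta0_neq0 : Theta0 !=set0) (Theta1_neq0 : Theta1 !=set0)
  (Y : set 'rV[R]_d2) (Y_neq0 : Y !=set0)
  (mu : {sigma_finite_measure set (trace_borel Y_neq0) -> \bar R})
  (f : 'rV[R]_d1 -> trace_borel Y_neq0 -> R)
  (f_density : density_family mu f Theta)
  (alpha : R) (alpha01 : 0 < alpha < 1)
  (g : R -> R) (g_measurable : measurable_fun (`[0, 1]%classic : set R) g)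
  (Lambda0 Lambda1 : probability (borel_rV R d1) R)
  (Lambda0_on : Lambda0 Theta0 = 1%E) (Lambda1_on : Lambda1 Theta1 = 1%E)
  (A1 : assumption_A1 mu f Theta) (A2 : assumption_A2 g) :
  let is_optimal :=
    optimal mu f Theta0 Theta1 Lambda0 Lambda1 g alpha in
  let has_form :=
    NP_form mu f Theta0 Theta1 Lambda0 Lambda1 g in
  [/\ (~ is_optimal (fun=> 0) ->
       exists (deltas : trace_borel Y_neq0 -> R) (kappa : R)
              (gamma : trace_borel Y_neq0 -> R),
         [/\ is_optimal deltas, Delta gamma &
             forall y, has_form deltas gamma kappa y]),
      (~ is_optimal (fun=> 0) ->
       forall deltas, is_optimal deltas ->
         exists (kappa : R) (gamma : trace_borel Y_neq0 -> R),
           Delta gamma /\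
           {ae mu, forall y, has_form deltas gamma kappa y}) &
      ((forall t, 0 < t < 1 -> 0 < g^`()%classic t) ->
       ~ is_optimal (fun=> 0) /\
       forall deltas, is_optimal deltas ->
         avg_size mu f Theta0 Lambda0 deltas = alpha)].
Proof.
split.
- move=> n0.
  have [delta [kappa [od form]]] := optimal_NP_form Theta_compact
    Theta0_measurable Theta0_sub Theta1E Theta0_neq0 f_density alpha01
    g_measurable Lambda0_on Lambda1_on A1 A2 n0.
  by exists delta, kappa, delta; split; [exact: od|exact: od.1.1|exact: form].
- move=> n0 delta od.
  have p_int := optimal_reject_prob_interior Theta0_measurable Theta0_sub
    Theta1E f_density alpha01 Lambda0_on A1 n0 od.
  have [kappa form] := optimal_NP_form_ae Theta_compact
    Theta0_measurable Theta0_sub Theta1E Theta0_neq0 f_density alpha01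
    g_measurable Lambda0_on A1 A2 od p_int.
  by exists kappa, delta; split; [exact: od.1.1|exact: form].
- move=> g'0; split.
    exact: (zero_rule_not_optimal Theta_compact Theta0_measurable
      Theta0_sub Theta1E f_density alpha01 g_measurable
      Lambda0_on Lambda1_on A1 A2 g'0).
  move=> delta od.
  exact: (optimal_exhausts_size Theta_compact Theta0_measurable
    Theta0_sub Theta1E f_density alpha01 g_measurable
    Lambda0_on Lambda1_on A1 A2 g'0 od).
Qed.
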